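(* For every convex body $K\subset\mathbb{R}^2$, $$\mathcal{C}(K)\ \geq\ \mathcal{C}(\Delta_{2,0})=108.$$
   Context: A convex body in $\mathbb{R}^n$ is a compact convex set with nonempty interior; $|K|$ is Lebesgue measure. The covariance matrix $\mathrm{Cov}(K)$ is the $n\times n$ matrix with entries $\mathrm{Cov}(K)_{ij}=\int_K x_ix_j\frac{dx}{|K|}-\int_K x_i\frac{dx}{|K|}\int_K x_j\frac{dx}{|K|}$, and $\mathcal{C}(K)=\frac{|K|^2}{\det\mathrm{Cov}(K)}$. $\Delta_{2,0}\subset\mathbb{R}^2$ is the triangle with vertices $(1,0)$, $(0,1)$, $(-1,-1)$. *)

(* Defs.v *)
From HB Require Import structures.
From mathcomp Require Import all_boot all_order all_algebra.
From mathcomp Require Import all_classical all_reals all_analysis.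

Set Implicit Arguments.
Unset Strict Implicit.
Unset Printing Implicit Defensive.

Import Order.TTheory GRing.Theory Num.Theory.
Import numFieldNormedType.Exports.

Local Open Scope classical_set_scope.
Local Open Scope ring_scope.

(* Points of the plane have type [R * R].  The factors are written [R^o]
   where the vector space structure is needed and [measurableTypeR R] where
   the Borel structure is; both are convertible to [R]. *)

Definition leb2 (R : realType) :
    {measure set (measurableTypeR R * measurableTypeR R) -> \bar R} :=
  (@lebesgue_measure R \x @lebesgue_measure R)%E.

Definition convex_body (R : realType) (K : set (R * R)) : Prop :=
  [/\ compact K,
      convex_set (K : set (convex_lmodType (R^o * R^o)%type)) &
      K° !=set0].

Definition volume (R : realType) (K : set (R * R)) : R := fine (leb2 R K).

Definition coord (R : realType) (i : 'I_2) (x : R * R) : R :=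
  if i == 0 then x.1 else x.2.

Definition mean (R : realType) (K : set (R * R)) (f : R * R -> R) : R :=
  (\int[leb2 R]_(x in K) f x) / volume K.

Definition Cov (R : realType) (K : set (R * R)) : 'M[R]_2 :=
  \matrix_(i, j) (mean K (fun x => coord i x * coord j x)
                  - mean K (coord i) * mean K (coord j)).

Definition calC (R : realType) (K : set (R * R)) : R :=
  volume K ^+ 2 / \det (Cov K).

Definition triangle (R : realType) (u v w : R^o * R^o) : set (R * R) :=
  [set p | exists a b c : R,
    [/\ 0 <= a, 0 <= b, 0 <= c, a + b + c = 1 &
        p = a *: u + b *: v + c *: w]].

Definition Delta20 (R : realType) : set (R * R) :=
  triangle (1, 0) (0, 1) (-1, -1).

(* Main.v *)
Require Import Defs.
From mathcomp Require Import all_boot all_order all_algebra.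
From mathcomp Require Import all_classical all_reals all_analysis.
From mathcomp Require Import measurable_realfun ring lra.
Set Implicit Arguments.
Unset Strict Implicit.
Unset Printing Implicit Defensive.
Import Order.TTheory GRing.Theory Num.Theory.
Import numFieldNormedType.Exports.
Local Open Scope classical_set_scope.
Local Open Scope ring_scope.

(** Why the triangle minimises [calC].  Write [V] for the area of a body.

    Shaking.  Slide every vertical chord of [K] until it stands on the
    horizontal axis.  This gives a convex body [shake K] of the same area, and
    det Cov does not decrease ([gram_shake]).  Indeed, let [K] be the set of
    the points (x, y) with b(x) <= y <= t(x).  The gain is a positive multiple
    of the covariance of the two concave functions -b and t, taken after
    removing from each its linear regression on [x], under the distribution of
    [x] in [K].  Such a covariance is nonnegative ([covn_concave]): the residual
    [r] of [t] is concave and has mean zero, so it is positive between two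
    points and negative outside, and the chord of -b through these two points
    can be subtracted from -b without changing the covariance; the difference
    has everywhere the sign of [r].

    A minimising sequence.  Suppose that V^2 mu <= det Cov for some body, with
    [mu] > 0.  Since [calC] is affine invariant, it suffices to consider bodies
    that satisfy this inequality and contain the triangle T with vertices
    (0, 0), (1, 0), (0, 1); their areas are at least 1/2.  Let [v] be the
    infimum of these areas and take such a body [K] of area less than
    (1 + e) v.  If [K] had a point with abscissa - d < 0, then [shake K] would
    contain the triangle with vertices (- d, 0), (1, 0), (0, 1), and the affine
    map that brings it back to T would produce an admissible body of area
    V / (1 + d) ([spread_shake]), whence d < e.  By the affine symmetries of T
    the same bound holds on the three sides, so [K] lies between T and the
    homothetic copy of T of ratio 1 + 3 e ([spread_near_minimal]).  For the
    quadratic form adapted to T this bounds the trace of the covariance, hence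
    its determinant, and gives 108 mu <= (1 + 3 e)^8 ([spread_squeezed]).  Let
    e tend to 0.

    Areas and moments are transported by two kinds of maps, each of which
    multiplies areas by a constant: the exchange of the coordinates, and the
    maps (x, y) |-> (x, b y + psi x) with [psi] measurable ([scales_fiber]).
    The latter include the elementary affine maps, the shaking itself, and the
    reflection of each vertical chord in its midpoint, which replaces
    integration along the chords. *)

Local Notation plane R := (measurableTypeR R * measurableTypeR R)%type.

(** * Maps that multiply areas by a constant *)

Section Measure.
Context {R : realType}.
Notation lambda := (@lebesgue_measure R).

Lemma measurable_affine1 (b c : R) :
  measurable_fun [set: measurableTypeR R]
    (fun y : measurableTypeR R => (b * y + c : measurableTypeR R)).
Proof. by apply: measurable_funD => //; apply: measurable_funM. Qed.

Lemma lebesgue_measure_affine (b c : R) (A : set (measurableTypeR R)) :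
  b != 0 -> measurable A ->
  lambda ((fun y => b * y + c) @^-1` A) = (`|b|^-1%:E * lambda A)%E.
Proof.
move=> b0 mA.
pose phi := (fun y : measurableTypeR R => (b * y + c : measurableTypeR R)).
have mphi : measurable_fun setT phi by exact: measurable_affine1.
have nb0 : 0 <= `|b| by [].
pose push : {measure set (measurableTypeR R) -> \bar R} :=
  mscale (NngNum nb0) (pushforward lambda phi).
have nb1 : (`|b| != 0 :> R) by rewrite normr_eq0.
suff <- : push mphi A = lambda A.
  rewrite /push/= /mscale/= muleA -EFinM mulVf// mul1e.
  by [].
symmetry; apply: lebesgue_measure_unique => // X /ocitvP[->|[[u v] /= uv ->]].
  by rewrite !measure0.
rewrite /push /mscale /pushforward /phi /=.
have := lt_total b0 => /orP[bneg|bpos].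
  rewrite [X in (_ * lebesgue_measure X)%E](_ : _ = [set` `[(v - c) / b, (u - c)/b[]); last first.
    apply/seteqP; split=> y; rewrite /= !in_itv/= => /andP[h1 h2]; apply/andP.
      rewrite ler_ndivrMr// ltr_ndivlMr//; split; lra.
    move: h1 h2; rewrite ler_ndivrMr// ltr_ndivlMr// => h1 h2; split; lra.
  rewrite !lebesgue_measure_itv/= !lte_fin uv ltr_ndivlMr// mulfVK// ltrD2r uv.
  by rewrite -!EFinD -EFinM ltr0_norm//; congr EFin; field.
rewrite [X in (_ * lebesgue_measure X)%E](_ : _ = [set` `](u - c) / b, (v - c)/b]]); last first.
  apply/seteqP; split=> y; rewrite /= !in_itv/= => /andP[h1 h2]; apply/andP.
    rewrite ler_pdivlMr// ltr_pdivrMr//; split; lra.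
  move: h1 h2; rewrite ler_pdivlMr// ltr_pdivrMr// => h1 h2; split; lra.
rewrite !lebesgue_measure_itv/= !lte_fin uv ltr_pdivlMr// mulfVK// ltrD2r uv.
by rewrite -!EFinD -EFinM gtr0_norm//; congr EFin; field.
Qed.

(** Preimages rather than images: they are measurable for every measurable [L],
    and the property passes to composites. *)
Definition scales (L : plane R -> plane R) (k : R) :=
  [/\ measurable_fun setT L, 0 < k &
   forall A, measurable A -> leb2 R (L @^-1` A) = (k%:E * leb2 R A)%E].

Lemma scales_comp L1 L2 k1 k2 : scales L1 k1 -> scales L2 k2 ->
  scales (L1 \o L2) (k1 * k2).
Proof.
move=> [mL1 k10 E1] [mL2 k20 E2]; split.
- exact: measurableT_comp.
- exact: mulr_gt0.
- move=> A mA; rewrite comp_preimage E2; last first.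
    by rewrite -[X in measurable X]setTI; exact: mL1.
  by rewrite E1// muleA -EFinM mulrC.
Qed.

(** By uniqueness of the product measure: both sides agree on rectangles. *)
Lemma scales_swap : scales (fun z => (z.2, z.1)) 1.
Proof.
have mS : measurable_fun setT (fun z : plane R => (z.2, z.1) : plane R) by exact: measurable_swap.
split => // A mA; rewrite mul1e.
pose push : {measure set (plane R) -> \bar R} :=
  pushforward (leb2 R) (fun z : plane R => (z.2, z.1) : plane R).
symmetry; change (leb2 R A = push mS A).
apply: (@product_measure_unique _ _ (measurableTypeR R) (measurableTypeR R) R
  lambda lambda (push mS)) => // B C mB mC.
transitivity (leb2 R (C `*` B)).
  congr (leb2 R _).
  by apply/seteqP; split => -[x y] /= [].
transitivity (lambda C * lambda B)%E; first exact: product_measure1E.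
exact: muleC.
Qed.

(** Each vertical line is mapped to itself by an affine map of slope [b], so the
    claim is Cavalieri's principle; [psi] need only be measurable. *)
Lemma scales_fiber (b : R) (psi : measurableTypeR R -> measurableTypeR R) : b != 0 ->
  measurable_fun setT psi ->
  scales (fun z => (z.1, b * z.2 + psi z.1)) `|b|^-1.
Proof.
move=> b0 mpsi.
have mE : measurable_fun setT (fun z : plane R => (z.1, b * z.2 + psi z.1) : plane R).
  apply: measurable_fun_pair => //.
  apply: measurable_funD; first by apply: measurable_funM.
  exact: measurableT_comp.
split => //; first by rewrite invr_gt0 normr_gt0.
move=> A mA; rewrite /leb2 /product_measure1.
rewrite -ge0_integralZl//; last exact: (measurable_fun_xsection lambda).
apply: eq_integral => x _ /=.
rewrite -(@lebesgue_measure_affine b (psi x))//; last exact: measurable_xsection.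
Qed.
End Measure.

(** * Integrals of bounded measurable functions *)

Section Integ.
Context {R : realType}.
Implicit Types (K : set (plane R)) (F G : plane R -> R).

Definition finite_area K := measurable K /\ (leb2 R K < +oo)%E.

(** Boundedness is only asked on [K] while measurability is global: products and
    composites with plane maps then stay in the class, and every such function
    is integrable on a set of finite area. *)
Definition tame K F :=
  measurable_fun setT F /\ exists M, forall z, K z -> `|F z| <= M.

Definition integ K F := \int[leb2 R]_(z in K) F z.

Lemma tame_cst K (c : R) : tame K (fun=> c).
Proof. by split; [exact: measurable_cst|exists `|c|]. Qed.

Lemma tameD K F G : tame K F -> tame K G -> tame K (fun z => F z + G z).
Proof.
move=> [mF [M FM]] [mG [N GN]]; split; first exact: measurable_funD.
exists (M + N) => z Kz; apply: (le_trans (ler_normD _ _)).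
by rewrite lerD ?FM ?GN.
Qed.

Lemma tameM K F G : tame K F -> tame K G -> tame K (fun z => F z * G z).
Proof.
move=> [mF [M FM]] [mG [N GN]]; split; first exact: measurable_funM.
by exists (M * N) => z Kz; rewrite normrM ler_pM ?FM ?GN.
Qed.

Lemma tameN K F : tame K F -> tame K (fun z => - F z).
Proof.
move=> [mF [M FM]]; split; first exact: measurableT_comp.
by exists M => z Kz; rewrite normrN FM.
Qed.

Lemma tameB K F G : tame K F -> tame K G -> tame K (fun z => F z - G z).
Proof. by move=> tF tG; apply: tameD => //; exact: tameN. Qed.

Lemma tameX K F n : tame K F -> tame K (fun z => F z ^+ n).
Proof.
move=> tF; elim: n => [|n IH]; first exact: tame_cst.
by under eq_fun do rewrite exprS; exact: tameM.
Qed.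

Lemma tame_comp K F L : measurable_fun setT L -> tame K F ->
  tame (L @^-1` K) (F \o L).
Proof.
move=> mL [mF [M FM]]; split; first exact: measurableT_comp.
by exists M => z /FM.
Qed.

Section OnK.
Variable K : set (plane R).
Hypothesis fK : finite_area K.

Lemma tame_integrable F : tame K F -> (leb2 R).-integrable K (EFin \o F).
Proof.
move=> [mF [M FM]]; apply: measurable_bounded_integrable.
- by case: fK.
- by case: fK.
- exact: measurable_funTS.
- exists M; split; first exact: num_real.
  by move=> x Mx z Kz /=; rewrite (le_trans (FM _ Kz))// ltW.
Qed.

Lemma integD F G : tame K F -> tame K G ->
  integ K (fun z => F z + G z) = integ K F + integ K G.
Proof. by move=> *; apply: RintegralD; [case: fK|exact: tame_integrable..]. Qed.

Lemma integZ c F : tame K F -> integ K (fun z => c * F z) = c * integ K F.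
Proof. by move=> *; apply: RintegralZl; [case: fK|exact: tame_integrable]. Qed.

Lemma integN F : tame K F -> integ K (fun z => - F z) = - integ K F.
Proof.
move=> tF; rewrite -mulN1r -integZ//; congr integ; apply/funext => z.
by rewrite mulN1r.
Qed.

Lemma integB F G : tame K F -> tame K G ->
  integ K (fun z => F z - G z) = integ K F - integ K G.
Proof. by move=> tF tG; rewrite integD ?integN//; exact: tameN. Qed.

Lemma integ_cst c : integ K (fun=> c) = c * volume K.
Proof. by rewrite /integ Rintegral_cst//; case: fK. Qed.

Lemma eq_integ F G : (forall z, K z -> F z = G z) -> integ K F = integ K G.
Proof. by move=> FG; apply: eq_Rintegral => z /set_mem /FG. Qed.

Lemma integ_ge0 F : (forall z, K z -> 0 <= F z) -> 0 <= integ K F.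
Proof. exact: Rintegral_ge0. Qed.

Lemma le_integ_set K' F : measurable K' -> K' `<=` K -> tame K F ->
  (forall z, K z -> 0 <= F z) -> integ K' F <= integ K F.
Proof.
move=> mK' s tF F0; have [mK fK2] := fK.
have fK' : finite_area K'.
  by split => //; apply: le_lt_trans fK2; apply: le_measure => //; rewrite inE.
have tI := tame_integrable tF.
apply: fine_le.
- by apply: integrable_fin_num => //; apply: (integrableS mK).
- exact: integrable_fin_num.
- apply: ge0_subset_integral => //.
  by case/integrableP : tI.
Qed.

Lemma scales_finite_area L k : scales L k -> finite_area (L @^-1` K).
Proof.
move=> [mL k0 E]; have [mK oK] := fK; split.
  by rewrite -[X in measurable X]setTI; exact: mL.
by rewrite E// lte_mul_pinfty// lee_fin ltW.
Qed.

Lemma scales_volume L k : scales L k -> volume (L @^-1` K) = k * volume K.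
Proof.
move=> [mL k0 E]; have [mK oK] := fK; rewrite /volume E// fineM//.
by rewrite ge0_fin_numE.
Qed.

(** Change of variables, through the image of [leb2 R] under [L], which is the
    multiple [k] of [leb2 R]. *)
Lemma integ_scales_ge0 L k F : scales L k -> tame K F ->
  (forall z, K z -> 0 <= F z) ->
  integ (L @^-1` K) (F \o L) = k * integ K F.
Proof.
move=> sL tF F0; have [mL k0 E] := sL; have [mK oK] := fK.
have kk0 : 0 <= k by exact: ltW.
have fL := scales_finite_area sL.
have tI := tame_integrable tF.
have mEF : measurable_fun K (EFin \o F) by case/integrableP : tI.
rewrite /integ /Rintegral.
have F0' : {in K, forall z, (0 <= (EFin \o F) z)%E} by move=> z /set_mem /F0.
have HH := ge0_integral_pushforward mL (leb2 R) mK mEF F0'.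
transitivity (fine (\int[mscale (NngNum kk0) (leb2 R)]_(z in K) (EFin \o F) z)).
  apply: (congr1 fine); apply: (eq_trans (esym HH)).
  apply: eq_measure_integral => A mA _.
  by rewrite /mscale; apply: (eq_trans (E A mA)).
have F0e z : K z -> (0 <= (EFin \o F) z)%E by move=> /F0.
have H3 := ge0_integral_mscale (leb2 R) mK (NngNum kk0) mEF F0e.
apply: (eq_trans (congr1 fine H3)).
have fin := integrable_fin_num mK tI.
exact: (fineM _ fin).
Qed.

End OnK.

Lemma integ_scales K L k F : finite_area K -> scales L k -> tame K F ->
  integ (L @^-1` K) (F \o L) = k * integ K F.
Proof.
move=> fK sL tF; have [mL k0 E] := sL.
have fL := scales_finite_area fK sL; have [_ [M FM]] := tF.
have tM K' := tame_cst K' M.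
have FM0 z : K z -> 0 <= F z + M.
  by move=> Kz; have := FM _ Kz; rewrite ler_norml => /andP[+ _]; lra.
have := integ_scales_ge0 fK sL (tameD tF (tM _)) FM0.
rewrite (integD fK)// (integ_cst fK).
rewrite [X in integ _ X](_ : _ = (fun z => (F \o L) z + M))//.
rewrite (integD fL) ?(integ_cst fL)//; last exact: tame_comp.
rewrite (scales_volume fK sL) => /eqP; rewrite -subr_eq0 => /eqP h.
by apply/eqP; rewrite -subr_eq0; apply/eqP; rewrite -h; ring.
Qed.
End Integ.

(** * Covariances without denominators *)

Section Covariance.
Context {R : realType}.
Implicit Types (K : set (plane R)) (F G : plane R -> R).

(** [volume K ^+ 2] times the covariance of [F] and [G] for the uniform
    distribution on [K]; this scaling avoids divisions. *)
Definition covn K F G :=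
  volume K * integ K (fun z => F z * G z) - integ K F * integ K G.

(** For the two coordinates, [volume K ^+ 4] times the determinant of [Cov K]. *)
Definition gram K F G := covn K F F * covn K G G - covn K F G ^+ 2.

Lemma covnC K F G : covn K F G = covn K G F.
Proof.
rewrite /covn [integ K F * _]mulrC; congr (_ * integ _ _ - _).
by apply/funext => z; rewrite mulrC.
Qed.

Section OnK.
Variable K : set (plane R).
Hypothesis fK : finite_area K.

Lemma covnDl F G H : tame K F -> tame K G -> tame K H ->
  covn K (fun z => F z + G z) H = covn K F H + covn K G H.
Proof.
move=> tF tG tH; rewrite /covn (integD fK)//.
rewrite (_ : (fun z => (F z + G z) * H z) = fun z => F z * H z + G z * H z).
  by rewrite (integD fK); [ring|exact: tameM..].
by apply/funext => z; rewrite mulrDl.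
Qed.

Lemma covnZl c F H : tame K F -> tame K H ->
  covn K (fun z => c * F z) H = c * covn K F H.
Proof.
move=> tF tH; rewrite /covn (integZ fK)//.
rewrite (_ : (fun z => c * F z * H z) = fun z => c * (F z * H z)).
  by rewrite (integZ fK); [ring|exact: tameM].
by apply/funext => z; rewrite mulrA.
Qed.

Lemma covn_cst c H : tame K H -> covn K (fun=> c) H = 0.
Proof.
by move=> tH; rewrite /covn (integZ fK)// (integ_cst fK); ring.
Qed.

Lemma covn_lin F G H a b c : tame K F -> tame K G -> tame K H ->
  covn K (fun z => a * F z + b * G z + c) H = a * covn K F H + b * covn K G H.
Proof.
move=> tF tG tH.
have t1 := tameM (tame_cst K a) tF; have t2 := tameM (tame_cst K b) tG.
by rewrite !covnDl ?covnZl ?covn_cst ?addr0//; [exact: tameD|exact: tame_cst].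
Qed.

Lemma gram_lin F G a b p c d q : tame K F -> tame K G ->
  gram K (fun z => a * F z + b * G z + p) (fun z => c * F z + d * G z + q) =
  (a * d - b * c) ^+ 2 * gram K F G.
Proof.
move=> tF tG.
have t a' b' p' : tame K (fun z => a' * F z + b' * G z + p').
  by do 2?apply: tameD; try apply: tameM => //; exact: tame_cst.
rewrite /gram !covn_lin//.
rewrite ![covn K _ (fun z => _ + _)]covnC !covn_lin// [covn K G F]covnC.
ring.
Qed.

Lemma covn_scales L k F G : scales L k -> tame K F -> tame K G ->
  covn (L @^-1` K) (F \o L) (G \o L) = k ^+ 2 * covn K F G.
Proof.
move=> sL tF tG; rewrite /covn (scales_volume fK sL) !(integ_scales fK sL)//.
rewrite [integ (L @^-1` K) _](_ : _ = k * integ K (fun z => F z * G z)); first ring.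
by rewrite -(integ_scales fK sL)//; exact: tameM.
Qed.

Lemma gram_scales L k F G : scales L k -> tame K F -> tame K G ->
  gram (L @^-1` K) (F \o L) (G \o L) = k ^+ 4 * gram K F G.
Proof. by move=> sL tF tG; rewrite /gram !(covn_scales sL)//; ring. Qed.

Lemma covn_diag F : tame K F -> 0 < volume K ->
  covn K F F =
  volume K * integ K (fun z => (F z - integ K F / volume K) ^+ 2).
Proof.
move=> tF A0; set m := integ K F / volume K.
rewrite (_ : (fun z => (F z - m) ^+ 2) =
  fun z => F z * F z + (- (2 * m)) * F z + m ^+ 2); last first.
  by apply/funext => z; ring.
have tt := tameM tF tF.
have t2 := tameM (tame_cst K (- (2 * m))) tF.
rewrite (integD fK); [|exact: tameD|exact: tame_cst].
rewrite (integD fK)// (integZ fK)// (integ_cst fK).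
have mE : integ K F = m * volume K by rewrite /m mulfVK// gt_eqF.
by rewrite /covn mE; ring.
Qed.

Lemma covn_ge0 F : tame K F -> 0 < volume K -> 0 <= covn K F F.
Proof.
move=> tF A0; rewrite covn_diag//.
by apply: mulr_ge0; [exact: ltW|apply: integ_ge0 => z _; exact: sqr_ge0].
Qed.
End OnK.
End Covariance.

(** * Correlation of concave functions *)

Section Concave.
Context {R : realType}.
Implicit Types (u r : R -> R) (a b : R).

(** The three-point form of concavity, cleared of denominators. *)
Definition concave_on a b u := forall x y z, a <= x -> x < y -> y < z -> z <= b ->
  u x * (z - y) + u z * (y - x) <= u y * (z - x).

(** The set where [r] is positive is an interval with ends [p] and [q]; the line
    is the chord of [u] over it.  Concavity of [u] puts [u] above its chord
    between [p] and [q] and below it elsewhere, which is also where [r] changes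
    sign. *)
Lemma concave_same_sign_line a b u r M :
  concave_on a b u -> concave_on a b r ->
  (forall x, a <= x <= b -> u x <= M) ->
  exists m k, forall x, a <= x <= b -> 0 <= (u x - (m + k * x)) * r x.
Proof.
move=> cu cr uM.
pose S := [set x | a <= x <= b /\ 0 < r x].
have [S0|/set0P[s0 Ss0]] := eqVneq S set0.
  exists M, 0 => x xab; rewrite mul0r addr0.
  have rx : r x <= 0.
    rewrite leNgt; apply/negP => rx; suff: S x by rewrite S0.
    by [].
  by rewrite mulr_le0// subr_le0 uM.
have hsup : has_sup S by split; [exists s0|exists b => x [/andP[]]].
have hinf : has_inf S by split; [exists s0|exists a => x [/andP[]]].
pose p := inf S; pose q := sup S.
have pS x : S x -> p <= x by move=> Sx; apply: ge_inf => //; case: hinf.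
have qS x : S x -> x <= q by move=> Sx; apply: sup_upper_bound.
have ap : a <= p by apply: lb_le_inf => [|x [/andP[]]//]; exists s0.
have qb : q <= b by apply: ge_sup => [|x [/andP[]]//]; exists s0.
have pq : p <= q by apply: (le_trans (pS _ Ss0)); exact: qS.
have outL x : a <= x -> x < p -> r x <= 0.
  move=> ax xp; rewrite leNgt; apply/negP => rx.
  have : p <= x by apply: pS; split => //; rewrite ax; lra.
  lra.
have outR x : x <= b -> q < x -> r x <= 0.
  move=> ax xp; rewrite leNgt; apply/negP => rx.
  have : x <= q by apply: qS; split => //; rewrite ax andbT; lra.
  lra.
have inside x : p < x -> x < q -> 0 <= r x.
  move=> px xq.
  have [s Ss sx] : exists2 s, S s & s < x.
    have xp0 : 0 < x - p by lra.
    have [s Ss] := inf_adherent xp0 hinf; rewrite -/p => sx; exists s => //; lra.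
  have [t St xt] : exists2 t, S t & x < t.
    have xp0 : 0 < q - x by lra.
    have [s' Ss'] := sup_adherent xp0 hsup; rewrite -/q => sx'; exists s' => //; lra.
  have [/andP[as_ sb] rs] := Ss; have [/andP[at_ tb] rt] := St.
  have := cr s x t as_ sx xt tb; nra.
move: pq; rewrite le_eqVlt => /predU1P[pq|pq]; last first.
  pose k := (u q - u p) / (q - p).
  have qp : q - p != 0 by lra.
  have kE : k * (q - p) = u q - u p by rewrite /k mulfVK.
  exists (u p - k * p), k => x /andP[ax xb].
  have -> : u x - (u p - k * p + k * x) = u x - u p - k * (x - p) by ring.
  have qp0 : 0 < q - p by lra.
  have [xp|px|->] := ltrgtP x p; last by rewrite !subrr mulr0 subr0 mul0r.
    rewrite mulr_le0// ?outL//.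
    have := cu x p q ax xp pq qb; nra.
  have [xq|qx|->] := ltrgtP x q; last by rewrite kE subrr mul0r.
    apply: mulr_ge0; last exact: inside.
    have := cu p x q ap px xq qb; nra.
  rewrite mulr_le0// ?outR//.
  have := cu p q x ap pq qx xb; nra.
(* If p = q then r is positive at one point only; moving slightly from it
   towards any other point of [a, b] keeps r positive, so a = b. *)
have Sp x : S x -> x = p by move=> Sx; have := pS _ Sx; have := qS _ Sx; rewrite -pq; lra.
have [/andP[as0 s0b] rs0] := Ss0.
have sp := Sp _ Ss0.
have single z : a <= z <= b -> z = s0.
  move=> /andP[az zb]; apply/eqP/negPn/negP => zs.
  pose t := r s0 / (2 * (r s0 + `|r z|)).
  have n0 : 0 <= `|r z| by [].
  have n1 : - `|r z| <= r z by rewrite lerNl ler_normr lexx orbT.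
  have den : 0 < 2 * (r s0 + `|r z|) by lra.
  have t0 : 0 < t by rewrite divr_gt0.
  have tE : t * (2 * (r s0 + `|r z|)) = r s0 by rewrite /t mulfVK ?gt_eqF.
  have t1 : t < 1 by rewrite ltr_pdivrMr//; lra.
  clearbody t.
  pose y := s0 + t * (z - s0).
  have ry : 0 < r y.
    have [zs0|s0z|e] := ltrgtP z s0; last by rewrite e eqxx in zs.
    - have p1 : 0 < (1 - t) * (s0 - z) by apply: mulr_gt0; lra.
      have p2 : 0 < t * (s0 - z) by apply: mulr_gt0; lra.
      have h1 : z < y by rewrite /y; lra.
      have h2 : y < s0 by rewrite /y; lra.
      have := cr z y s0 az h1 h2 s0b; set ry := r y; rewrite /y => H.
      have p3 : 0 <= (r z + `|r z|) * (t * (s0 - z)) by apply: mulr_ge0; lra.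
      have tE2 : t * (2 * (r s0 + `|r z|)) * (s0 - z) = r s0 * (s0 - z) by rewrite tE.
      have p4 : 0 < r s0 * (s0 - z) by apply: mulr_gt0; lra.
      have : 0 < ry * (s0 - z) by lra.
      by rewrite pmulr_lgt0//; lra.
    - have p1 : 0 < (1 - t) * (z - s0) by apply: mulr_gt0; lra.
      have p2 : 0 < t * (z - s0) by apply: mulr_gt0; lra.
      have h1 : y < z by rewrite /y; lra.
      have h2 : s0 < y by rewrite /y; lra.
      have := cr s0 y z as0 h2 h1 zb; set ry := r y; rewrite /y => H.
      have p3 : 0 <= (r z + `|r z|) * (t * (z - s0)) by apply: mulr_ge0; lra.
      have tE2 : t * (2 * (r s0 + `|r z|)) * (z - s0) = r s0 * (z - s0) by rewrite tE.
      have p4 : 0 < r s0 * (z - s0) by apply: mulr_gt0; lra.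
      have : 0 < ry * (z - s0) by lra.
      by rewrite pmulr_lgt0//; lra.
  have : y = p.
    apply: Sp; split => //; rewrite /y; apply/andP; split.
    - have [/ltW h|h] := ltP (z - s0) 0; nra.
    - have [/ltW h|h] := ltP (z - s0) 0; nra.
  rewrite -sp /y => /eqP; rewrite -subr_eq0 [s0 + _]addrC addrK mulf_eq0 subr_eq0 (negbTE zs) orbF.
  by rewrite gt_eqF.
by exists (u s0), 0 => x /single ->; rewrite mul0r addr0 subrr mul0r.
Qed.
End Concave.

Section ConcaveCov.
Context {R : realType}.
Implicit Types (K : set (plane R)) (u v : R -> R).

Definition xc (z : plane R) : R := z.1.
Definition yc (z : plane R) : R := z.2.

(** This is the nonnegativity of the covariance of [u] and [v] after removing
    their linear regressions on the abscissa, multiplied by the variance of the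
    abscissa.  The residual [r] of [v] has zero mean and is uncorrelated with
    the abscissa, so [u] may be replaced by its difference with any affine
    function, in particular the one of [concave_same_sign_line]. *)
Lemma covn_concave K u v a b M : finite_area K -> 0 < volume K ->
  (forall z, K z -> a <= z.1 <= b) ->
  tame K xc -> tame K (fun z => u z.1) -> tame K (fun z => v z.1) ->
  concave_on a b u -> concave_on a b v ->
  (forall x, a <= x <= b -> u x <= M) ->
  0 < covn K xc xc ->
  covn K xc (fun z => u z.1) * covn K xc (fun z => v z.1) <=
  covn K xc xc * covn K (fun z => u z.1) (fun z => v z.1).
Proof.
move=> fK A0 Kab tx tu tv cu cv uM cxx.
set U := fun z : plane R => u z.1; set V := fun z : plane R => v z.1.
pose be := covn K xc V / covn K xc xc.
pose al := (integ K V - be * integ K xc) / volume K.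
pose r x := v x - be * x - al.
have tr : tame K (fun z => r z.1).
  apply: tameB; last exact: tame_cst.
  by apply: tameB => //; apply: tameM => //; exact: tame_cst.
have rE : (fun z : plane R => r z.1) = fun z => (- be) * xc z + 1 * V z + (- al).
  by apply/funext => z; rewrite /r /xc /V; ring.
have cr : concave_on a b r.
  by move=> x y z ax xy yz zb; have := cv x y z ax xy yz zb; rewrite /r; lra.
have beE : be * covn K xc xc = covn K xc V by rewrite /be mulfVK// gt_eqF.
have alE : al * volume K = integ K V - be * integ K xc by rewrite /al mulfVK// gt_eqF.
have t1 := tameM (tame_cst K (- be)) tx; have t2 := tameM (tame_cst K 1) tv.
have r0 : integ K (fun z => r z.1) = 0.
  rewrite rE (integD fK)//; [|exact: tameD|exact: tame_cst].
  by rewrite (integD fK)// !(integZ fK)// (integ_cst fK) !mulNr alE; ring.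
have cxr : covn K (fun z => r z.1) xc = 0.
  by rewrite rE covn_lin// [covn K V xc]covnC -beE; ring.
have xr0 : integ K (fun z => r z.1 * z.1) = 0.
  move: cxr; rewrite /covn r0 mul0r subr0 => /eqP; rewrite mulf_eq0 gt_eqF//=.
  by move/eqP.
have cur : covn K U (fun z => r z.1) = covn K U V - be * covn K U xc.
  by rewrite covnC rE covn_lin// [covn K V U]covnC [covn K xc U]covnC; ring.
have [m [k Hmk]] := concave_same_sign_line cu cr uM.
have cur0 : 0 <= covn K U (fun z => r z.1).
  have tur := tameM tu tr.
  rewrite /covn r0 mulr0 subr0; apply: mulr_ge0; first exact: ltW.
  have -> : integ K (fun z => U z * r z.1) =
      integ K (fun z => (u z.1 - (m + k * z.1)) * r z.1).
    rewrite (_ : (fun z : plane R => (u z.1 - (m + k * z.1)) * r z.1) =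
       fun z => U z * r z.1 + ((- m) * r z.1 + (- k) * (r z.1 * z.1))); last first.
      by apply/funext => z; rewrite /U; ring.
    have trx := tameM tr tx.
    have t3 := tameM (tame_cst K (- m)) tr; have t4 := tameM (tame_cst K (- k)) trx.
    rewrite (integD fK)//; last exact: tameD.
    rewrite (integD fK)// !(integZ fK)// r0.
    by rewrite xr0 !mulr0 !addr0.
  by apply: integ_ge0 => z Kz; exact/Hmk/Kab.
rewrite -beE -subr_ge0 [covn K xc U]covnC.
rewrite (_ : _ - _ = covn K xc xc * covn K U (fun z => r z.1)); last by rewrite cur; ring.
by rewrite mulr_ge0// ltW.
Qed.
End ConcaveCov.

(** * Affine maps and covariances *)

Section Affine.
Context {R : realType}.
Implicit Types (K : set (plane R)).

Definition aff (a b p c d q : R) (z : plane R) : plane R :=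
  (a * z.1 + b * z.2 + p, c * z.1 + d * z.2 + q).

(** For [a != 0] the matrix factors into a map that fixes the ordinate, which is
    a fibre map conjugated by the exchange of coordinates, followed by a fibre
    map. *)
Lemma scales_aff a b p c d q : a != 0 -> a * d - b * c != 0 ->
  scales (aff a b p c d q) `|a * d - b * c|^-1.
Proof.
move=> a0 D0.
pose S : plane R -> plane R := fun z => (z.2, z.1).
pose E1 : plane R -> plane R := fun z => (z.1, a * z.2 + (b * z.1 + p)).
have d0 : (a * d - b * c) / a != 0 by rewrite mulf_neq0 ?invr_eq0.
pose E2 : plane R -> plane R := fun z =>
  (z.1, ((a * d - b * c) / a) * z.2 + (c / a * z.1 + (q - c / a * p))).
have s1 : scales E1 `|a|^-1 := scales_fiber a0 (measurable_affine1 b p).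
have s2 : scales E2 `|(a * d - b * c) / a|^-1 := scales_fiber d0 (measurable_affine1 _ _).
have := scales_comp s2 (scales_comp (@scales_swap R) (scales_comp s1 (@scales_swap R))).
rewrite mulr1 mul1r -invfM normrM normfV mulfVK ?normr_eq0//.
rewrite (_ : E2 \o _ = aff a b p c d q)//.
by apply/funext => z; rewrite /E2 /E1 /aff /=; congr pair; field.
Qed.

End Affine.

Section GramAffine.
Context {R : realType}.
Implicit Types (K : set (plane R)).

(** Areas are divided by the determinant [D] and covariance determinants by
    [D ^+ 2]; the factor [volume ^+ 4] in [gram] accounts for the rest. *)
Lemma gram_aff K a b p c d q : finite_area K -> tame K xc -> tame K yc ->
  a != 0 -> a * d - b * c != 0 ->
  gram (aff a b p c d q @^-1` K) xc yc = gram K xc yc / (a * d - b * c) ^+ 6.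
Proof.
move=> fK tx ty a0 D0; set L := aff a b p c d q; set D := a * d - b * c in D0 *.
have sL : scales L `|D|^-1 by exact: scales_aff.
have fL := scales_finite_area fK sL.
have mL : measurable_fun setT L by case: sL.
have tXL : tame (L @^-1` K) (xc \o L) := tame_comp mL tx.
have tYL : tame (L @^-1` K) (yc \o L) := tame_comp mL ty.
pose X z := d / D * (xc \o L) z + (- b / D) * (yc \o L) z + (b * q - d * p) / D.
pose Y z := (- c / D) * (xc \o L) z + (a / D) * (yc \o L) z + (c * p - a * q) / D.
have -> : gram (L @^-1` K) xc yc = gram (L @^-1` K) X Y.
  by congr (gram _ _ _); apply/funext => z;
    rewrite /X /Y /xc /yc /L /aff /=; rewrite /D; field.
rewrite gram_lin// (gram_scales fK sL)//.
have -> : d / D * (a / D) - - b / D * (- c / D) = D^-1 by rewrite /D; field.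
have -> : `|D|^-1 ^+ 4 = D^-1 ^+ 4.
  by rewrite -normfV -normrX ger0_norm// exprn_even_ge0.
by field.
Qed.

Lemma volume_aff K a b p c d q : finite_area K ->
  a != 0 -> a * d - b * c != 0 ->
  volume (aff a b p c d q @^-1` K) = volume K / `|a * d - b * c|.
Proof.
move=> fK a0 D0.
by rewrite (scales_volume fK (scales_aff _ _ a0 D0)) mulrC.
Qed.
End GramAffine.

(** * Compact convex sets of the plane and their upper and lower boundaries *)

Section Body.
Context {R : realType}.
Implicit Types (K : set (R * R)).

Definition convex2 K := forall z w t, K z -> K w -> 0 <= t <= 1 ->
  K (t * z.1 + (1 - t) * w.1, t * z.2 + (1 - t) * w.2).

Definition body K := compact K /\ convex2 K.

Lemma continuous_aff (a b p c d q : R) :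
  continuous (aff a b p c d q : R * R -> R * R).
Proof.
move=> z; apply: (@cvg_pair _ _ _ _ (nbhs (a * z.1 + b * z.2 + p)) (nbhs (c * z.1 + d * z.2 + q))).
  by apply: cvgD; [apply: cvgD; apply: cvgMr; [exact: cvg_fst|exact: cvg_snd]|exact: cvg_cst].
by apply: cvgD; [apply: cvgD; apply: cvgMr; [exact: cvg_fst|exact: cvg_snd]|exact: cvg_cst].
Qed.

Lemma body_aff K (a b p c d q : R) : a * d - b * c != 0 -> body K ->
  body (aff a b p c d q @^-1` K).
Proof.
move=> D0 [cK vK]; set D := a * d - b * c in D0; split.
  pose M := aff (d / D) (- b / D) ((b * q - d * p) / D) (- c / D) (a / D) ((c * p - a * q) / D).
  rewrite (_ : _ @^-1` K = M @` K).
    apply: continuous_compact cK; apply: continuous_subspaceT.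
    exact: continuous_aff.
  apply/seteqP; split=> [z Kz|z [w Kw <-]] /=.
    exists (aff a b p c d q z) => //.
    by rewrite [RHS]surjective_pairing /M /aff /=; congr pair; rewrite /D; field.
  rewrite (_ : aff a b p c d q (M w) = w)//.
  by rewrite [RHS]surjective_pairing /M /aff /=; congr pair; rewrite /D; field.
move=> z w t Kz Kw t01 /=.
rewrite (_ : aff _ _ _ _ _ _ _ = (t * (aff a b p c d q z).1 + (1 - t) * (aff a b p c d q w).1,
   t * (aff a b p c d q z).2 + (1 - t) * (aff a b p c d q w).2)); first exact: vK.
by rewrite /aff /=; congr pair; ring.
Qed.

Lemma body_swap K : body K -> body ((fun z => (z.2, z.1)) @^-1` K).
Proof.
move=> [cK vK]; split.
  rewrite (_ : _ @^-1` K = (fun z : R * R => (z.2, z.1)) @` K).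
    apply: continuous_compact cK; apply: continuous_subspaceT => z.
    by apply: (@cvg_pair _ _ _ _ (nbhs z.2) (nbhs z.1)); [exact: cvg_snd|exact: cvg_fst].
  apply/seteqP; split=> [z Kz|z [w Kw <-]] /=.
    by exists (z.2, z.1) => //; rewrite -surjective_pairing.
  by rewrite -surjective_pairing.
by move=> z w t Kz Kw t01 /=; exact: (vK _ _ t Kz Kw).
Qed.

Lemma compact_coord_bounded K : compact K ->
  exists M, forall z, K z -> `|z.1| <= M /\ `|z.2| <= M.
Proof.
move=> cK.
have c1 : compact (fst @` K).
  by apply: continuous_compact cK; apply: continuous_subspaceT => z; exact: cvg_fst.
have c2 : compact (snd @` K).
  by apply: continuous_compact cK; apply: continuous_subspaceT => z; exact: cvg_snd.
have /ex_strict_bound_gt0[k1 k10 /= h1] := @compact_bounded _ R^o _ c1.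
have /ex_strict_bound_gt0[k2 k20 /= h2] := @compact_bounded _ R^o _ c2.
exists (k1 + k2) => z Kz; split.
  by have := h1 z.1 (ex_intro2 _ _ z Kz erefl) => /ltW; lra.
by have := h2 z.2 (ex_intro2 _ _ z Kz erefl) => /ltW; lra.
Qed.

Definition is_top K x y := K (x, y) /\ forall y', K (x, y') -> y' <= y.

(** The default value makes [top K] constant off the projection of [K], hence
    measurable on the whole line. *)
Definition top K x : R := xget 0 [set y | is_top K x y].

Lemma topP K x y : compact K -> K (x, y) -> is_top K x (top K x).
Proof.
move=> cK Kxy.
have cA : compact (K `&` (fst @^-1` [set x])).
  apply: compact_closedI => //.
  by apply: preimage_closed; [move=> z _; exact: cvg_fst|exact: closed_eq].
have [||c /set_mem [Kc cx] cmax] := @compact_EVT_max _ R (snd : R * R -> R) _ _ cA.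
- by exists (x, y).
- by apply: continuous_subspaceT => z; exact: cvg_snd.
suff h : is_top K x c.2 by exact: (@xgetPex _ 0 [set y | is_top K x y] (ex_intro _ _ h)).
split.
  by rewrite -cx -surjective_pairing.
by move=> y' Ky'; apply: (cmax (x, y')); apply/mem_set.
Qed.

Lemma top_out K x : ~ (exists y, K (x, y)) -> top K x = 0.
Proof.
by move=> nK; rewrite /top; case: xgetP => // y _ [Ky _]; case: nK; exists y.
Qed.

Lemma convex2_between K x y1 y2 y : convex2 K -> K (x, y1) -> K (x, y2) ->
  y1 <= y <= y2 -> K (x, y).
Proof.
move=> vK K1 K2 /andP[y1y yy2].
move: y1y; rewrite le_eqVlt => /predU1P[<-//|y1y].
have y12 : 0 < y2 - y1 by lra.
have := vK _ _ ((y2 - y) / (y2 - y1)) K1 K2 => /=.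
rewrite (_ : _ * x + _ = x); last by ring.
rewrite (_ : _ * y1 + _ = y); last by field; rewrite gt_eqF.
apply; apply/andP; split; first by rewrite divr_ge0; lra.
by rewrite ler_pdivrMr//; lra.
Qed.

Lemma convex2_chord K x z w y1 y2 : convex2 K -> K (x, y1) -> K (z, y2) ->
  x < w -> w < z -> exists2 y, K (w, y) & y * (z - x) = y1 * (z - w) + y2 * (w - x).
Proof.
move=> vK K1 K2 xw wz; have xz : 0 < z - x by lra.
exists ((z - w) / (z - x) * y1 + (1 - (z - w) / (z - x)) * y2); last first.
  by field; rewrite gt_eqF.
have := vK _ _ ((z - w) / (z - x)) K1 K2 => /=.
rewrite (_ : _ * x + _ = w); last by field; rewrite gt_eqF.
apply; apply/andP; split; first by rewrite divr_ge0; lra.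
by rewrite ler_pdivrMr//; lra.
Qed.

Lemma is_interval_above K t : convex2 K ->
  is_interval [set x | exists2 y, t <= y & K (x, y)].
Proof.
move=> vK x z [y1 ty1 K1] [y2 ty2 K2] w /andP[xw wz] /=.
move: xw wz; rewrite !le_eqVlt => /predU1P[<-|xw]; first by exists y1.
move=> /predU1P[->|wz]; first by exists y2.
have [y Ky E] := convex2_chord vK K1 K2 xw wz; exists y => //.
have xz : 0 < z - x by lra.
by rewrite -(ler_pM2r xz) E; nra.
Qed.

Lemma is_interval_fst K : convex2 K -> is_interval [set x | exists y, K (x, y)].
Proof.
move=> vK x z [y1 K1] [y2 K2] w /andP[xw wz] /=.
move: xw wz; rewrite !le_eqVlt => /predU1P[<-|xw]; first by exists y1.
move=> /predU1P[->|wz]; first by exists y2.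
by have [y Ky E] := convex2_chord vK K1 K2 xw wz; exists y.
Qed.

(** Superlevel sets of the upper boundary are projections of convex sets, hence
    intervals, up to the points off the projection of [K]. *)
Lemma measurable_top K : body K ->
  measurable_fun [set: measurableTypeR R]
    (top K : measurableTypeR R -> measurableTypeR R).
Proof.
move=> [cK vK].
apply: (measurability _ (RGenCInfty.measurableE R)) => _ [_ [t ->] <-].
rewrite setTI.
pose J := [set x | exists y, K (x, y)].
have mJ : measurable (J : set (measurableTypeR R)).
  by apply: is_interval_measurable; exact: is_interval_fst.
have mt : measurable ([set x | exists2 y, t <= y & K (x, y)] : set (measurableTypeR R)).
  by apply: is_interval_measurable; exact: is_interval_above.
have [t0|t0] := leP t 0.
  rewrite (_ : _ @^-1` _ = [set x | exists2 y, t <= y & K (x, y)] `|` ~` J).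
    by apply: measurableU => //; exact: measurableC.
  apply/seteqP; split=> x /=; rewrite in_itv/= andbT.
    move=> tx; have [Jx|] := pselect (J x); last by right.
    by have [y Ky] := Jx; left; exists (top K x) => //; have [] := topP cK Ky.
  move=> [[y ty Ky]|nJ]; last by rewrite top_out.
  by have [_ /(_ _ Ky)] := topP cK Ky; exact: le_trans.
rewrite (_ : _ @^-1` _ = [set x | exists2 y, t <= y & K (x, y)])//.
apply/seteqP; split=> x /=; rewrite in_itv/= andbT.
  move=> tx; have [[y Ky]|nJ] := pselect (J x).
    by exists (top K x) => //; have [] := topP cK Ky.
  by move: tx; rewrite top_out// leNgt t0.
move=> [y ty Ky].
by have [_ /(_ _ Ky)] := topP cK Ky; exact: le_trans.
Qed.

(** Reflection in the horizontal axis transfers to the lower boundary what is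
    known of the upper one. *)
Definition flip K := aff 1 0 0 0 (-1) 0 @^-1` K.

Lemma flipE K x y : flip K (x, y) = K (x, - y).
Proof. by rewrite /flip /aff /=; congr (K (_, _)); ring. Qed.

Definition bot K x := - top (flip K) x.

Lemma body_flip K : body K -> body (flip K).
Proof. by apply: body_aff; rewrite mul0r subr0 mul1r oppr_eq0 oner_eq0. Qed.

Lemma botP K x y : body K -> K (x, y) ->
  K (x, bot K x) /\ forall y', K (x, y') -> bot K x <= y'.
Proof.
move=> /body_flip [cK' _] Kxy.
have Fxy : flip K (x, - y) by rewrite flipE opprK.
have [] := topP cK' Fxy; rewrite flipE => Kb h; split => // y' Ky'.
by rewrite /bot lerNl; apply: h; rewrite flipE opprK.
Qed.

Lemma measurable_bot K : body K ->
  measurable_fun [set: measurableTypeR R]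
    (bot K : measurableTypeR R -> measurableTypeR R).
Proof. by move=> /body_flip /measurable_top h; exact: measurableT_comp. Qed.

Lemma body_bot_topE K : body K -> K =
  [set z | exists y, K (z.1, y)] `&` [set z | bot K z.1 <= z.2 <= top K z.1].
Proof.
move=> bK; have [cK vK] := bK; apply/seteqP; split => -[x y] /=.
  move=> Kxy; split; first by exists y.
  have [_ /(_ _ Kxy) ->] := botP bK Kxy.
  by have [_ /(_ _ Kxy) ->] := topP cK Kxy.
move=> [[y' Ky'] h].
have [K1 _] := botP bK Ky'; have [K2 _] := topP cK Ky'.
exact: convex2_between h.
Qed.

(** [K] is the region between its two boundary functions, over its projection. *)
Lemma measurable_body K : body K -> measurable (K : set (plane R)).
Proof.
move=> bK; have [cK vK] := bK; rewrite (body_bot_topE bK); apply: measurableI.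
  rewrite (_ : mkset _ = (fst : plane R -> measurableTypeR R) @^-1` [set x | exists y, K (x, y)])//.
  rewrite -[X in measurable X]setTI; apply: measurable_fst => //.
  by apply: is_interval_measurable; exact: is_interval_fst.
pose f1 (z : plane R) : measurableTypeR R := z.2 - bot K z.1.
pose f2 (z : plane R) : measurableTypeR R := top K z.1 - z.2.
have m1 : measurable_fun setT f1.
  apply: measurable_funB => //; apply: measurableT_comp => //; exact: measurable_bot.
have m2 : measurable_fun setT f2.
  apply: measurable_funB => //; apply: measurableT_comp => //; exact: measurable_top.
rewrite (_ : mkset _ = (f1 @^-1` `[0, +oo[) `&` (f2 @^-1` `[0, +oo[)).
  by apply: measurableI; rewrite -[X in measurable X]setTI; [apply: m1|apply: m2].
apply/seteqP; split => z /=; rewrite !in_itv/= !andbT /f1 /f2 !subr_ge0.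
  by move/andP.
by move=> [-> ->].
Qed.

Lemma finite_area_bounded (K : set (plane R)) M : measurable K ->
  (forall z, K z -> `|z.1| <= M /\ `|z.2| <= M) -> finite_area K.
Proof.
move=> mK KM; split => //.
pose I : set (measurableTypeR R) := [set` `[- M, M]].
have KI : K `<=` I `*` I.
  by move=> z /KM[h1 h2]; rewrite /I; split; rewrite /= in_itv/= -ler_norml.
apply: (@le_lt_trans _ _ (leb2 R (I `*` I))).
  apply: le_measure => //; rewrite inE//.
  by apply: measurableX; exact: measurable_itv.
apply: (@le_lt_trans _ _ (lebesgue_measure I * lebesgue_measure I)%E).
  rewrite le_eqVlt; apply/orP; left; apply/eqP.
  by apply: product_measure1E; exact: measurable_itv.
by rewrite lebesgue_measure_itv/=; case: ifP => _; rewrite ?mul0e// -EFinB -EFinM ltry.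
Qed.

Lemma finite_area_body K : body K -> finite_area K.
Proof.
move=> bK; have [M KM] := compact_coord_bounded bK.1.
exact: (finite_area_bounded (measurable_body bK) KM).
Qed.

Lemma tame_xc K : body K -> tame K xc.
Proof.
move=> bK; have [M KM] := compact_coord_bounded bK.1; split; first exact: measurable_fst.
by exists M => z /KM[].
Qed.

Lemma tame_yc K : body K -> tame K yc.
Proof.
move=> bK; have [M KM] := compact_coord_bounded bK.1; split; first exact: measurable_snd.
by exists M => z /KM[].
Qed.

Lemma tame_top K : body K -> tame K (fun z => top K z.1).
Proof.
move=> bK; have [M KM] := compact_coord_bounded bK.1; split.
  by apply: measurableT_comp => //; exact: measurable_top.
exists M => z Kz; have Kz' : K (z.1, z.2) by rewrite -surjective_pairing.
by have [/KM[]] := topP bK.1 Kz'.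
Qed.

Lemma tame_bot K : body K -> tame K (fun z => bot K z.1).
Proof.
move=> bK; have [M KM] := compact_coord_bounded bK.1; split.
  by apply: measurableT_comp => //; exact: measurable_bot.
exists M => z Kz; have Kz' : K (z.1, z.2) by rewrite -surjective_pairing.
by have [/KM[]] := botP bK Kz'.
Qed.

End Body.

(** * Moments of the triangle with vertices (0, 0), (1, 0), (0, 1) *)

Section UnitTriangle.
Context {R : realType}.

Definition unit_triangle : set (plane R) := [set z | [/\ 0 <= z.1, 0 <= z.2 & z.1 + z.2 <= 1]].

Lemma measurable_unit_triangle : measurable unit_triangle.
Proof.
pose f3 (z : plane R) : measurableTypeR R := 1 - (z.1 + z.2).
have m3 : measurable_fun setT f3 by apply: measurable_funB => //; apply: measurable_funD.
rewrite (_ : unit_triangle =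
  (fst @^-1` `[0, +oo[) `&` ((snd @^-1` `[0, +oo[) `&` (f3 @^-1` `[0, +oo[))).
  do 2?apply: measurableI; rewrite -[X in measurable X]setTI.
  - exact: (@measurable_fst _ _ (measurableTypeR R) (measurableTypeR R)).
  - exact: (@measurable_snd _ _ (measurableTypeR R) (measurableTypeR R)).
  - exact: m3.
apply/seteqP; split => z /=; rewrite !in_itv/= !andbT /f3 subr_ge0.
  by case.
by move=> [? []].
Qed.

Lemma unit_triangle_bounded z : unit_triangle z -> `|z.1| <= 1 /\ `|z.2| <= 1.
Proof. by move=> [h1 h2 h3]; split; rewrite ler_norml; apply/andP; split; lra. Qed.

Lemma finite_area_unit_triangle : finite_area unit_triangle.
Proof. exact: (finite_area_bounded measurable_unit_triangle unit_triangle_bounded). Qed.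

Lemma tame_unit_triangle_xc : tame unit_triangle xc.
Proof. by split; [exact: measurable_fst|exists 1 => z /unit_triangle_bounded[]]. Qed.

Lemma tame_unit_triangle_yc : tame unit_triangle yc.
Proof. by split; [exact: measurable_snd|exists 1 => z /unit_triangle_bounded[]]. Qed.

(** The vertical chord at [x] has length [1 - x], so these powers integrate to
    those on the unit interval; they determine all moments of the abscissa. *)
Lemma integ_unit_triangle_onem k : integ unit_triangle (fun z => (1 - z.1) ^+ k) = k.+2%:R^-1.
Proof.
rewrite /integ /Rintegral integral_mkcond.
set f := (fun z : plane R => ((1 - z.1) ^+ k)%:E) \_ unit_triangle.
have f0 z : (0 <= f z)%E.
  rewrite /f patchE; case: ifPn => // /set_mem [h1 h2 h3].
  by rewrite lee_fin exprn_ge0//; lra.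
have mf : measurable_fun setT f.
  apply/(measurable_restrictT _ measurable_unit_triangle).
  apply/measurable_EFinP; apply: measurable_funTS; apply: measurable_funX.
  by apply: measurable_funB => //.
apply: (eq_trans (congr1 fine (fubini_tonelli1 f mf f0))).
rewrite -Rintegral_onemXn /Rintegral [in RHS]integral_mkcond.
apply: (congr1 fine); apply: eq_integral => x _.
rewrite /fubini_F /f patchE; case: ifPn => [/set_mem|/negP nx]; last first.
  apply: integral0_eq => y _; rewrite patchE; case: ifPn => // /set_mem [/= h1 h2 h3].
  by case: nx; apply/mem_set; rewrite /= in_itv/=; apply/andP; split; lra.
rewrite /= in_itv/= => /andP[x0 x1].
pose I : set (measurableTypeR R) := [set` `[0, 1 - x]].
transitivity (\int[lebesgue_measure]_(y in I) ((1 - x) ^+ k)%:E)%E.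
  rewrite [RHS]integral_mkcond; apply: eq_integral => y _.
  rewrite !patchE; congr (if _ then _ else _).
  apply/idP/idP => /set_mem.
    by move=> [/= h1 h2 h3]; apply/mem_set; rewrite /I /= in_itv/=; apply/andP; split; lra.
  by rewrite /I /= in_itv/= => /andP[h1 h2]; apply/mem_set; split => /=; lra.
have mI : lebesgue_measure I = (1 - x)%:E.
  rewrite /I lebesgue_measure_itv/= lte_fin subr_gt0; case: ifPn => h.
    by rewrite -EFinB subr0.
  by congr EFin; move: h; rewrite -leNgt; lra.
rewrite integral_cst; last exact: measurable_itv.
by apply: (eq_trans (congr1 (fun t => _ * t)%E mI)); rewrite -EFinM -exprSr.
Qed.

Lemma volume_unit_triangle : volume unit_triangle = 2^-1.
Proof.
rewrite -(integ_unit_triangle_onem 0) (_ : (fun z : plane R => (1 - z.1) ^+ 0) = fun=> 1).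
  by rewrite (integ_cst finite_area_unit_triangle) mul1r.
by apply/funext => z; rewrite expr0.
Qed.

Lemma integ_unit_triangle_xc : integ unit_triangle xc = 6^-1.
Proof.
have := integ_unit_triangle_onem 1.
rewrite (_ : (fun z : plane R => (1 - z.1) ^+ 1) = fun z => 1 - xc z).
  rewrite (integB finite_area_unit_triangle) ?(integ_cst finite_area_unit_triangle) ?volume_unit_triangle.
  - lra.
  - exact: tame_cst.
  - exact: tame_unit_triangle_xc.
by apply/funext => z; rewrite expr1.
Qed.

Lemma integ_unit_triangle_xx : integ unit_triangle (fun z => xc z * xc z) = 12^-1.
Proof.
have fT := finite_area_unit_triangle; have tx := tame_unit_triangle_xc; have txx := tameM tx tx.
have t2 := tameM (tame_cst unit_triangle (- 2)) tx; have tc := tame_cst unit_triangle 1.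
have := integ_unit_triangle_onem 2.
rewrite (_ : (fun z : plane R => (1 - z.1) ^+ 2) = fun z => xc z * xc z + ((- 2) * xc z + 1)).
  rewrite (integD fT)//; last exact: tameD.
  by rewrite (integD fT)// (integZ fT)// (integ_cst fT) volume_unit_triangle integ_unit_triangle_xc; lra.
by apply/funext => z; rewrite /xc; ring.
Qed.

Lemma integ_unit_triangle_swap F : tame unit_triangle F ->
  integ unit_triangle (fun z => F (z.2, z.1)) = integ unit_triangle F.
Proof.
move=> tF; have := integ_scales finite_area_unit_triangle (@scales_swap R) tF.
rewrite mul1r => <-; congr (integ _ _).
by apply/seteqP; split => -[x y] [/= h1 h2 h3]; split => /=; lra.
Qed.

Lemma integ_unit_triangle_yc : integ unit_triangle yc = 6^-1.
Proof. by rewrite -integ_unit_triangle_xc -(integ_unit_triangle_swap tame_unit_triangle_xc). Qed.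

Lemma integ_unit_triangle_yy : integ unit_triangle (fun z => yc z * yc z) = 12^-1.
Proof. by rewrite -integ_unit_triangle_xx -(integ_unit_triangle_swap (tameM tame_unit_triangle_xc tame_unit_triangle_xc)). Qed.

(** The triangle is invariant under the affine permutations of its vertices; the
    one that maps [x] to [1 - x - y] expresses the mixed moment by the others. *)
Lemma integ_unit_triangle_xy : integ unit_triangle (fun z => xc z * yc z) = 24^-1.
Proof.
have fT := finite_area_unit_triangle; have tx := tame_unit_triangle_xc; have ty := tame_unit_triangle_yc.
have D0 : (-1 : R) * 1 - (-1) * 0 != 0 by rewrite mulr0 subr0 mulr1 oppr_eq0 oner_eq0.
have a0 : (-1 : R) != 0 by rewrite oppr_eq0 oner_eq0.
have txx := tameM tx tx; have tyy := tameM ty ty; have txy := tameM tx ty.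
have := integ_scales fT (scales_aff 1 0 a0 D0) txx.
rewrite (_ : aff _ _ _ _ _ _ @^-1` unit_triangle = unit_triangle); last first.
  by apply/seteqP; split => -[x y] [/= h1 h2 h3]; split => /=; lra.
rewrite mulr1 mulr0 subr0 normrN normr1 invr1 mul1r integ_unit_triangle_xx.
rewrite (_ : _ \o _ = fun z => xc z * xc z + (2 * (xc z * yc z) + (yc z * yc z +
    ((-2) * xc z + ((-2) * yc z + 1))))); last first.
  by apply/funext => z; rewrite /aff /xc /yc /=; ring.
have t1 := tameM (tame_cst unit_triangle 2) txy.
have t2 := tameM (tame_cst unit_triangle (-2)) tx; have t3 := tameM (tame_cst unit_triangle (-2)) ty.
have t4 := tame_cst unit_triangle 1.
have t5 := tameD t3 t4; have t6 := tameD t2 t5; have t7 := tameD tyy t6.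
have t8 := tameD t1 t7.
rewrite !(integD fT)// !(integZ fT)// (integ_cst fT) volume_unit_triangle.
rewrite integ_unit_triangle_xx integ_unit_triangle_yy integ_unit_triangle_xc integ_unit_triangle_yc; lra.
Qed.

Lemma integ_unit_triangle_sqr (a b c : R) :
  integ unit_triangle (fun z => (a * xc z + b * yc z + c) ^+ 2) =
  (a ^+ 2 + a * b + b ^+ 2) / 12 + (a + b) * c / 3 + c ^+ 2 / 2.
Proof.
have fT := finite_area_unit_triangle; have tx := tame_unit_triangle_xc; have ty := tame_unit_triangle_yc.
have txx := tameM tx tx; have tyy := tameM ty ty; have txy := tameM tx ty.
rewrite (_ : (fun z => _) = fun z => a ^+ 2 * (xc z * xc z) + (2 * a * b * (xc z * yc z)
   + (b ^+ 2 * (yc z * yc z) + (2 * a * c * xc z + (2 * b * c * yc z + c ^+ 2))))); last first.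
  by apply/funext => z; ring.
have tc k F : tame unit_triangle F -> tame unit_triangle (fun z => k * F z) by move=> ?; apply: tameM => //; exact: tame_cst.
have t1 := tc (a ^+ 2) _ txx; have t2 := tc (2 * a * b) _ txy.
have t3 := tc (b ^+ 2) _ tyy; have t4 := tc (2 * a * c) _ tx.
have t5 := tc (2 * b * c) _ ty; have t6 := tame_cst unit_triangle (c ^+ 2).
have s5 := tameD t5 t6; have s4 := tameD t4 s5; have s3 := tameD t3 s4; have s2 := tameD t2 s3.
rewrite !(integD fT)// (integ_cst fT) !(integZ fT)// volume_unit_triangle.
by rewrite integ_unit_triangle_xx integ_unit_triangle_yy integ_unit_triangle_xy integ_unit_triangle_xc integ_unit_triangle_yc; field.
Qed.

Lemma gram_unit_triangle : gram unit_triangle xc yc = 3 / 144 ^+ 2.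
Proof.
rewrite /gram /covn volume_unit_triangle integ_unit_triangle_xx integ_unit_triangle_yy integ_unit_triangle_xy integ_unit_triangle_xc integ_unit_triangle_yc.
by field.
Qed.
End UnitTriangle.

(** * Shaking *)

Section Shake.
Context {R : realType}.
Implicit Types (K : set (R * R)).

(** Differences of the ordinates of two points on a vertical chord.  Written so,
    [shake K] is visibly a linear image of a compact convex set. *)
Definition shake K : set (R * R) :=
  [set z | exists y y', [/\ K (z.1, y), K (z.1, y'), z.2 = y - y' & 0 <= z.2]].

Lemma body_shake K : body K -> body (shake K).
Proof.
move=> [cK vK]; split.
  pose S : set ((R * R) * (R * R)) :=
    (K `*` K) `&` ((fun p => p.1.1 - p.2.1) @^-1` [set 0] `&`
                   (fun p => p.1.2 - p.2.2) @^-1` [set x | 0 <= x]).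
  rewrite (_ : shake K = (fun p : (R * R) * (R * R) => (p.1.1, p.1.2 - p.2.2)) @` S).
    have c11 : continuous (fun p : (R * R) * (R * R) => p.1.1).
      by move=> p; apply: (@cvg_comp _ _ _ fst fst); [exact: cvg_fst|exact: cvg_fst].
    have c12 : continuous (fun p : (R * R) * (R * R) => p.1.2).
      by move=> p; apply: (@cvg_comp _ _ _ fst snd); [exact: cvg_fst|exact: cvg_snd].
    have c21 : continuous (fun p : (R * R) * (R * R) => p.2.1).
      by move=> p; apply: (@cvg_comp _ _ _ snd fst); [exact: cvg_snd|exact: cvg_fst].
    have c22 : continuous (fun p : (R * R) * (R * R) => p.2.2).
      by move=> p; apply: (@cvg_comp _ _ _ snd snd); [exact: cvg_snd|exact: cvg_snd].
    apply: continuous_compact.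
      apply: continuous_subspaceT => p.
      apply: (@cvg_pair _ _ _ _ (nbhs p.1.1) (nbhs (p.1.2 - p.2.2))); first exact: c11.
      by apply: cvgB; [exact: c12|exact: c22].
    apply: compact_closedI; first exact: compact_setX.
    apply: closedI; apply: preimage_closed.
    - by move=> p _; apply: cvgB; [exact: c11|exact: c21].
    - exact: closed_eq.
    - by move=> p _; apply: cvgB; [exact: c12|exact: c22].
    - exact: closed_ge.
  apply/seteqP; split => [[x t] [y [y' [/= K1 K2 tE t0]]]|_ [[[x y] [x' y']] [/= [K1 K2] [/eqP xx' h]] <-]] /=.
    exists ((x, y), (x, y')); last by rewrite /= tE.
    by split => //=; split => /=; [rewrite subrr|rewrite -tE].
  exists y, y'; split => //=.
  by move: xx'; rewrite subr_eq0 => /eqP ->.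
move=> [x1 t1] [x2 t2] t [y1 [y1' [/= K1 K1' e1 p1]]] [y2 [y2' [/= K2 K2' e2 p2]]] t01.
exists (t * y1 + (1 - t) * y2), (t * y1' + (1 - t) * y2'); split => /=.
- exact: (vK _ _ t K1 K2).
- exact: (vK _ _ t K1' K2').
- by rewrite e1 e2; ring.
- by move/andP: t01 => [h1 h2]; apply: addr_ge0; apply: mulr_ge0 => //; lra.
Qed.

(** Subtracting the lower boundary slides the chords of [K] to those of
    [shake K]; [scales_fiber] then transports areas and moments. *)
Lemma shake_pull K : body K ->
  (fun z : R * R => (z.1, 1 * z.2 + - bot K z.1)) @^-1` (shake K) = K.
Proof.
move=> bK; have [cK vK] := bK; apply/seteqP; split => -[x y] /=.
  move=> [y1 [y2 [/= K1 K2 e h]]].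
  have [Kb bl] := botP bK K1.
  apply: (convex2_between (y1 := bot K x) (y2 := y1) vK Kb K1).
  have := bl _ K2; lra.
move=> Kxy; have [Kb bl] := botP bK Kxy.
exists y, (bot K x); split => //=; first by rewrite mul1r.
by have := bl _ Kxy; rewrite mul1r; lra.
Qed.

Lemma reflect_pull K : body K ->
  (fun z : R * R => (z.1, -1 * z.2 + (bot K z.1 + top K z.1))) @^-1` K = K.
Proof.
move=> bK; have [cK vK] := bK.
have key x y : K (x, y) -> K (x, - 1 * y + (bot K x + top K x)).
  move=> Kxy; have [Kb bl] := botP bK Kxy; have [Kt tl] := topP cK Kxy.
  apply: (convex2_between vK Kb Kt).
  by have := bl _ Kxy; have := tl _ Kxy; lra.
apply/seteqP; split => -[x y] /= h; last exact: key.
by have := key _ _ h; rewrite (_ : - 1 * _ + _ = y)//; ring.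
Qed.

Lemma body_fst_segment K z0 : body K -> K z0 ->
  exists a b, forall x, a <= x <= b <-> exists y, K (x, y).
Proof.
move=> [cK vK] K0.
have cf : {within K, continuous (fst : R * R -> R)}.
  by apply: continuous_subspaceT => z; exact: cvg_fst.
have K0' : K !=set0 by exists z0.
have [ca /set_mem Ka amin] := compact_EVT_min K0' cK cf.
have [cb /set_mem Kb bmax] := compact_EVT_max K0' cK cf.
exists ca.1, cb.1 => x; split.
  move=> h; have itv := is_interval_fst vK; apply: (itv ca.1 cb.1) => //.
    by exists ca.2; rewrite -surjective_pairing.
  by exists cb.2; rewrite -surjective_pairing.
by move=> [y /mem_set Ky]; rewrite (amin _ Ky) (bmax _ Ky).
Qed.

Lemma concave_top K a b : body K ->
  (forall x, a <= x <= b -> exists y, K (x, y)) -> concave_on a b (top K).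
Proof.
move=> [cK vK] Jab x y z ax xy yz zb.
have [y1 K1] : exists y, K (x, y) by apply: Jab; lra.
have [y3 K3] : exists y, K (z, y) by apply: Jab; lra.
have [Kx _] := topP cK K1; have [Kz _] := topP cK K3.
have [w Kw <-] := convex2_chord vK Kx Kz xy yz.
have [_ /(_ _ Kw) h] := topP cK Kw.
by apply: ler_wpM2r => //; lra.
Qed.

(** Reflecting each vertical chord in its midpoint preserves [K] and its area
    measure and exchanges [y] with [bot + top - y]; so against a function of
    the abscissa, [y] may be replaced by the midpoint of the chord. *)
Lemma covn_reflect K (phi : plane R -> R) : body K -> tame K phi ->
  (forall x y y', phi (x, y) = phi (x, y')) ->
  covn K phi yc = (covn K phi (fun z => bot K z.1) + covn K phi (fun z => top K z.1)) / 2.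
Proof.
move=> bK tp phix; have fK := finite_area_body bK.
have tb := tame_bot bK; have tt := tame_top bK; have ty := tame_yc bK.
have m1 : (-1 : R) != 0 by rewrite oppr_eq0 oner_eq0.
have sr := scales_fiber m1 (measurable_funD (measurable_bot bK) (measurable_top bK)).
have half (psi : plane R -> R) : tame K psi -> (forall x y y', psi (x, y) = psi (x, y')) ->
   integ K (fun z => psi z * yc z) =
   (integ K (fun z => psi z * bot K z.1) + integ K (fun z => psi z * top K z.1)) / 2.
  move=> ts psix.
  have tpy := tameM ts ty; have tpb := tameM ts tb; have tpt := tameM ts tt.
  have := integ_scales fK sr tpy; rewrite reflect_pull// normrN normr1 invr1 mul1r.
  rewrite (_ : _ \o _ = fun z => (-1) * (psi z * yc z) +
      (psi z * bot K z.1 + psi z * top K z.1)); last first.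
    apply/funext => -[x y] /=; rewrite (psix x _ y) /yc /=; ring.
  rewrite (integD fK); [|by apply: tameM => //; exact: tame_cst|exact: tameD].
  by rewrite (integZ fK)// (integD fK)//; lra.
have h1 := half phi tp phix.
have one := half (fun=> 1) (tame_cst K 1) (fun _ _ _ => erefl).
have E (F : plane R -> R) : (fun z => 1 * F z) = F by apply/funext => z; rewrite mul1r.
by rewrite /covn h1; move: one; rewrite !E => ->; field.
Qed.

(** With [B] and [T] the lower and upper boundaries and [c] for [covn K], the
    reflection turns the gain into [c x B * c x T - c x x * c B T]; by
    [covn_concave] for the concave functions [- B] and [T], it is nonnegative. *)
Lemma gram_shake K : body K -> 0 < volume K -> 0 < covn K xc xc ->
  gram K xc yc <= gram (shake K) xc yc.
Proof.
move=> bK A0 cxx; have fK := finite_area_body bK; have [cK vK] := bK.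
have bS := body_shake bK; have fS := finite_area_body bS.
have tx := tame_xc bK; have ty := tame_yc bK.
have tb := tame_bot bK; have tt := tame_top bK.
set B := fun z : plane R => bot K z.1; set T := fun z : plane R => top K z.1.
have mb : measurable_fun setT (fun x : measurableTypeR R => - bot K x : measurableTypeR R).
  by apply: measurableT_comp => //; exact: measurable_bot.
have sE := scales_fiber (oner_neq0 R) mb.
have := gram_scales fS sE (tame_xc bS) (tame_yc bS).
rewrite shake_pull// normr1 invr1 expr1n mul1r => <-.
rewrite (_ : xc \o _ = xc)// (_ : yc \o _ = fun z => 1 * yc z + (-1) * B z + 0); last first.
  by apply/funext => z; rewrite /yc /B /=; ring.
have tL : tame K (fun z => 1 * yc z + (-1) * B z + 0).
  apply: tameD; last exact: tame_cst.
  by apply: tameD; apply: tameM => //; exact: tame_cst.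
rewrite /gram [X in _ <= _ - X ^+ 2]covnC !covn_lin//.
rewrite ![covn K _ (fun z => _ + _)]covnC !covn_lin//.
have cBy : covn K B yc = (covn K B B + covn K B T) / 2 by exact: covn_reflect.
have cxy : covn K xc yc = (covn K xc B + covn K xc T) / 2 by exact: covn_reflect.
rewrite [covn K yc B]covnC [covn K yc xc]covnC [covn K B xc]covnC cBy cxy.
have [z0 K0] : K !=set0.
  apply/set0P/negP => /eqP K0; move: A0; rewrite K0 /volume measure0 /=.
  by rewrite ltxx.
have [a [b Jab]] := body_fst_segment bK K0.
have Kab z : K z -> a <= z.1 <= b.
  by move=> Kz; apply/Jab; exists z.2; rewrite -surjective_pairing.
have bF := body_flip bK; have [M FM] := compact_coord_bounded bF.1.
have uM x : a <= x <= b -> top (flip K) x <= M.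
  move=> /Jab[y Ky]; have Fy : flip K (x, - y) by rewrite flipE opprK.
  have [/FM[_ /= h] _] := topP bF.1 Fy.
  exact: le_trans (ler_norm _) h.
have cu : concave_on a b (top (flip K)).
  by apply: concave_top => // x /Jab[y Ky]; exists (- y); rewrite flipE opprK.
have cv : concave_on a b (top K) by apply: concave_top => // x /Jab.
have UE : (fun z : plane R => top (flip K) z.1) = fun z => (-1) * B z.
  by apply/funext => z; rewrite /B /bot; ring.
have tu : tame K (fun z => top (flip K) z.1).
  by rewrite UE; apply: tameM => //; exact: tame_cst.
have := covn_concave fK A0 Kab tx tu tt cu cv uM cxx.
rewrite UE [covn K xc (fun z => -1 * _)]covnC !covnZl// [covn K B xc]covnC -/T.
lra.
Qed.

Lemma volume_shake K : body K -> volume (shake K) = volume K.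
Proof.
move=> bK; have bS := body_shake bK; have fS := finite_area_body bS.
have mb : measurable_fun setT (fun x : measurableTypeR R => - bot K x : measurableTypeR R).
  by apply: measurableT_comp => //; exact: measurable_bot.
have := scales_volume fS (scales_fiber (oner_neq0 R) mb).
by rewrite shake_pull// normr1 invr1 mul1r.
Qed.
End Shake.

(** * Bodies that contain the unit triangle *)

Section Normalised.
Context {R : realType}.
Implicit Types (K : set (R * R)).

(** Every convex body has an affine image of this form.  Such a body contains the
    unit triangle, so integrals of nonnegative functions are at least those over
    the triangle. *)
Definition normal_body K := [/\ body K, K (0, 0), K (1, 0) & K (0, 1)].

Lemma unit_triangle_sub K : normal_body K -> (unit_triangle : set (R * R)) `<=` K.
Proof.
move=> [[_ vK] K00 K10 K01] [x y] [/= x0 y0 xy1].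
have [s0|s0] := eqVneq (x + y) 0.
  by have [-> ->] : x = 0 /\ y = 0 by split; lra.
have sp : 0 < x + y by rewrite lt_neqAle eq_sym s0; lra.
have t01 : 0 <= x / (x + y) <= 1.
  by apply/andP; split; [rewrite divr_ge0 //; lra|rewrite ler_pdivrMr//; lra].
have := vK _ _ _ K10 K01 t01 => /= KP.
have := vK _ _ (x + y) KP K00 => /=.
rewrite (_ : _ + (1 - (x + y)) * 0 = x); last by field.
rewrite (_ : _ + (1 - (x + y)) * 0 = y); last by field.
by apply; apply/andP; split; lra.
Qed.

Lemma normal_volume K : normal_body K -> 2^-1 <= volume K.
Proof.
move=> nK; have [bK _ _ _] := nK; have fK := finite_area_body bK.
have := le_integ_set fK measurable_unit_triangle (unit_triangle_sub nK) (tame_cst K 1) (fun _ _ => ler01).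
by rewrite (integ_cst fK) (integ_cst finite_area_unit_triangle) volume_unit_triangle !mul1r.
Qed.

Lemma normal_volume_gt0 K : normal_body K -> 0 < volume K.
Proof. by move/normal_volume => h; lra. Qed.

Lemma normal_sqr_gt0 K a b c : normal_body K -> (a != 0) || (b != 0) ->
  0 < integ K (fun z => (a * xc z + b * yc z + c) ^+ 2).
Proof.
move=> nK ab; have [bK _ _ _] := nK; have fK := finite_area_body bK.
have tF : tame K (fun z => (a * xc z + b * yc z + c) ^+ 2).
  apply: tameX; apply: tameD; last exact: tame_cst.
  by apply: tameD; (apply: tameM; first exact: tame_cst); [exact: tame_xc|exact: tame_yc].
have := le_integ_set fK measurable_unit_triangle (unit_triangle_sub nK) tF (fun z _ => sqr_ge0 _).
apply: lt_le_trans; rewrite integ_unit_triangle_sqr.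
have -> : (a ^+ 2 + a * b + b ^+ 2) / 12 + (a + b) * c / 3 + c ^+ 2 / 2 =
  (c + (a + b) / 3) ^+ 2 / 2 + (a - b) ^+ 2 / 72 + (a ^+ 2 + b ^+ 2) / 72 by field.
have h : 0 < a ^+ 2 + b ^+ 2.
  by case/orP: ab => h; [apply: ltr_pwDl|apply: ltr_wpDl]; rewrite ?sqr_ge0// exprn_even_gt0.
by have := sqr_ge0 (c + (a + b) / 3); have := sqr_ge0 (a - b); lra.
Qed.

Lemma covn_lin_gt0 K a b : normal_body K -> (a != 0) || (b != 0) ->
  0 < covn K (fun z => a * xc z + b * yc z + 0) (fun z => a * xc z + b * yc z + 0).
Proof.
move=> nK ab; have [bK _ _ _] := nK; have fK := finite_area_body bK.
have tF : tame K (fun z => a * xc z + b * yc z + 0).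
  apply: tameD; last exact: tame_cst.
  by apply: tameD; (apply: tameM; first exact: tame_cst); [exact: tame_xc|exact: tame_yc].
have V0 := normal_volume_gt0 nK.
rewrite covn_diag//; apply: mulr_gt0 => //.
set m := _ / _.
rewrite (_ : (fun z => _) = fun z => (a * xc z + b * yc z + (- m)) ^+ 2).
  exact: normal_sqr_gt0.
by apply/funext => z; rewrite addr0.
Qed.

Lemma normal_covn_xx K : normal_body K -> 0 < covn K xc xc.
Proof.
move=> nK; have := @covn_lin_gt0 K 1 0 nK; rewrite oner_neq0 => /(_ isT).
by rewrite (_ : (fun z => _) = xc)//; apply/funext => z; rewrite mul1r mul0r !addr0.
Qed.

(** The variance of the linear form [c x x * y - c x y * x], where [c] stands for
    [covn K], equals [c x x * gram K xc yc]. *)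
Lemma normal_gram_gt0 K : normal_body K -> 0 < gram K xc yc.
Proof.
move=> nK; have [bK _ _ _] := nK; have fK := finite_area_body bK.
have tx := tame_xc bK; have ty := tame_yc bK.
have cx := normal_covn_xx nK.
have := @covn_lin_gt0 K (- covn K xc yc) (covn K xc xc) nK.
rewrite (gt_eqF cx) orbT => /(_ isT).
set l := fun z : plane R => _.
have tl : tame K l.
  apply: tameD; last exact: tame_cst.
  by apply: tameD; apply: tameM => //; exact: tame_cst.
rewrite {1}/l covn_lin// [covn K xc l]covnC [covn K yc l]covnC !covn_lin//.
rewrite [covn K yc xc]covnC => h.
rewrite -(pmulr_rgt0 _ cx) /gram.
by move: h; congr (0 < _); ring.
Qed.
End Normalised.

(** * Almost extremal bodies are almost triangles *)

Section Extremal.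
Context {R : realType}.
Implicit Types (K : set (R * R)) (mu : R).

(** The inequality is [mu * volume K ^+ 2 <= \det (Cov K)] times [volume K ^+ 4]. *)
Definition spread mu K := normal_body K /\ mu * volume K ^+ 6 <= gram K xc yc.

(** [shake K] contains [(z.1, 0)], [(1, 0)] and [(0, 1)], a triangle larger than
    the unit one by the factor [1 - z.1]; the new body is the preimage of
    [shake K] under the affine map that fixes the last two vertices and sends
    the origin to the first. *)
Lemma spread_shake mu K z : spread mu K -> K z -> z.1 < 0 ->
  exists2 K', spread mu K' & volume K' = volume K / (1 - z.1).
Proof.
move=> [nK hmu] Kz z0; have [bK K00 K10 K01] := nK.
have bS := body_shake bK; have fS := finite_area_body bS.
pose de := - z.1; have de0 : 0 < de by rewrite /de; lra.
have a0 : 1 + de != 0 by lra.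
have D0 : (1 + de) * 1 - de * 0 != 0 by lra.
have DE : (1 + de) * 1 - de * 0 = 1 + de by ring.
have V : volume (aff (1 + de) de (- de) 0 1 0 @^-1` shake K) = volume K / (1 + de).
  rewrite volume_aff// volume_shake// DE ger0_norm//; lra.
exists (aff (1 + de) de (- de) 0 1 0 @^-1` shake K); last by rewrite V.
split; last first.
  rewrite V gram_aff//; [|exact: tame_xc|exact: tame_yc].
  rewrite DE expr_div_n mulrA; apply: ler_wpM2r.
    by rewrite invr_ge0 exprn_ge0//; lra.
  apply: (le_trans hmu); apply: gram_shake => //.
    exact: normal_volume_gt0 nK.
  exact: normal_covn_xx.
split; first exact: body_aff.
- exists z.2, z.2; rewrite /aff /=.
  rewrite (_ : _ + - de = z.1); last by rewrite /de; ring.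
  by rewrite -surjective_pairing; split => //; ring.
- exists 0, 0; rewrite /aff /=.
  rewrite (_ : _ + - de = 1); last by ring.
  by split => //; ring.
- exists 1, 0; rewrite /aff /=.
  rewrite (_ : _ + - de = 0); last by ring.
  by split => //; ring.
Qed.

Lemma spread_swap mu K : spread mu K ->
  spread mu ((fun z => (z.2, z.1)) @^-1` K) /\
  volume ((fun z : plane R => (z.2, z.1)) @^-1` K) = volume K.
Proof.
move=> [nK hmu]; have [bK K00 K10 K01] := nK; have fK := finite_area_body bK.
have V : volume ((fun z : plane R => (z.2, z.1)) @^-1` K) = volume K.
  by rewrite (scales_volume fK (@scales_swap R)) mul1r.
split; last exact: V.
split; last first.
  rewrite V; apply: (le_trans hmu).
  have := gram_scales fK (@scales_swap R) (tame_yc bK) (tame_xc bK).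
  rewrite expr1n mul1r /gram [covn K yc xc]covnC [covn K yc yc * _]mulrC => <-.
  by [].
by split => //; exact: body_swap.
Qed.

Lemma spread_permute mu K : spread mu K ->
  spread mu (aff (-1) (-1) 1 0 1 0 @^-1` K) /\
  volume (aff (-1) (-1) 1 0 1 0 @^-1` K) = volume K.
Proof.
move=> [nK hmu]; have [bK K00 K10 K01] := nK; have fK := finite_area_body bK.
have a0 : (-1 : R) != 0 by rewrite oppr_eq0 oner_eq0.
have DE : (-1 : R) * 1 - (-1) * 0 = -1 by ring.
have D0 : (-1 : R) * 1 - (-1) * 0 != 0 by rewrite DE.
have V : volume (aff (-1) (-1) 1 0 1 0 @^-1` K) = volume K.
  by rewrite volume_aff// DE normrN normr1 divr1.
split; last exact: V.
split; last first.
  rewrite V (gram_aff _ _ fK (tame_xc bK) (tame_yc bK) a0 D0).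
  by rewrite DE -signr_odd /= expr0 divr1.
split; first exact: body_aff.
- rewrite /preimage /= (_ : aff _ _ _ _ _ _ _ = (1, 0)); first exact: K10.
  by rewrite /aff /=; congr pair; ring.
- rewrite /preimage /= (_ : aff _ _ _ _ _ _ _ = (0, 0)); first exact: K00.
  by rewrite /aff /=; congr pair; ring.
- rewrite /preimage /= (_ : aff _ _ _ _ _ _ _ = (0, 1)); first exact: K01.
  by rewrite /aff /=; congr pair; ring.
Qed.

(** [spread_shake] bounds the excess of [K] over the side on the axis of
    ordinates; the other two sides reduce to it by the symmetries of the
    triangle, which keep areas and [gram]. *)
Lemma spread_near_minimal mu K e : spread mu K ->
  (forall K', spread mu K' -> volume K < (1 + e) * volume K') ->
  forall z, K z -> [/\ - e <= z.1, - e <= z.2 & z.1 + z.2 <= 1 + e].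
Proof.
move=> sK minK.
have key K1 : spread mu K1 -> volume K1 = volume K -> forall z, K1 z -> - e <= z.1.
  move=> sK1 V1 z K1z; rewrite leNgt; apply/negP => ze.
  have V0 : 0 < volume K by case: sK => /normal_volume_gt0.
  have e0 : 0 < 1 + e.
    have := minK _ sK; rewrite -[X in X < _]mul1r ltr_pM2r//; lra.
  have z0 : z.1 < 0.
    have := minK _ sK; rewrite -[X in X < _]mul1r ltr_pM2r//; lra.
  have [K' sK' V'] := spread_shake sK1 K1z z0.
  have z1 : 0 < 1 - z.1 by lra.
  have := minK _ sK'; rewrite V' V1 mulrA (ltr_pdivlMr _ _ z1).
  by rewrite mulrC (ltr_pM2r V0); lra.
move=> z Kz; split.
- exact: key Kz.
- have [sS VS] := spread_swap sK.
  by apply: (key _ sS VS (z.2, z.1)); rewrite /= -surjective_pairing.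
- have [sP VP] := spread_permute sK.
  have := key _ sP VP (1 - z.1 - z.2, z.2) => /=; rewrite /aff /=.
  rewrite (_ : _ + 1 = z.1); last by ring.
  rewrite (_ : _ + 0 = z.2); last by ring.
  by rewrite -surjective_pairing => /(_ Kz); lra.
Qed.

Lemma covn_le_sqr K F (m : R) : finite_area K -> tame K F ->
  covn K F F <= volume K * integ K (fun z => (F z - m) ^+ 2).
Proof.
move=> fK tF.
rewrite (_ : (fun z => (F z - m) ^+ 2) =
  fun z => F z * F z + ((- (2 * m)) * F z + m ^+ 2)); last first.
  by apply/funext => z; ring.
have tt := tameM tF tF; have t2 := tameM (tame_cst K (- (2 * m))) tF.
have tm := tame_cst K (m ^+ 2).
rewrite (integD fK)//; last exact: tameD.
rewrite (integD fK)// (integ_cst fK) (integZ fK)// /covn -subr_ge0.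
rewrite (_ : _ - _ = (integ K F - m * volume K) ^+ 2); first exact: sqr_ge0.
ring.
Qed.

(** The form [Q] below is x^2 + x y + y^2 centred at the centroid of the triangle;
    up to a factor it is the inverse of the covariance matrix of the triangle.
    Its integral over [K] is at most that over the dilated triangle, and it
    bounds the trace form [c x x + c x y + c y y], where [c] stands for
    [covn K]; the square of this form is at least [3 * gram K xc yc]. *)
Lemma spread_squeezed mu K e : 0 <= e -> spread mu K ->
  (forall z, K z -> [/\ - e <= z.1, - e <= z.2 & z.1 + z.2 <= 1 + e]) ->
  108 * mu <= (1 + 3 * e) ^+ 8.
Proof.
move=> e0 [nK hmu] Ke; have [bK _ _ _] := nK; have fK := finite_area_body bK.
have tx := tame_xc bK; have ty := tame_yc bK.
set c := 1 + 3 * e; have c0 : 0 < c by rewrite /c; lra.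
have c1 : c != 0 by rewrite gt_eqF.
pose G : plane R -> plane R := aff c^-1 0 (e / c) 0 c^-1 (e / c).
have ci0 : c^-1 != 0 by rewrite invr_eq0.
have D0 : c^-1 * c^-1 - 0 * 0 != 0 by rewrite mul0r subr0 mulf_neq0.
have sG : scales G `|c^-1 * c^-1 - 0 * 0|^-1 by exact: scales_aff.
have kE : `|c^-1 * c^-1 - 0 * 0|^-1 = c ^+ 2.
  rewrite mul0r subr0 ger0_norm; first by field.
  by rewrite mulr_ge0// invr_ge0 ltW.
rewrite kE in sG.
have KG : K `<=` G @^-1` unit_triangle.
  move=> z /Ke[h1 h2 h3]; rewrite /G /aff; split => /=.
  - rewrite mul0r addr0 [e / c]mulrC -mulrDr mulr_ge0 ?invr_ge0; lra.
  - rewrite mul0r add0r [e / c]mulrC -mulrDr mulr_ge0 ?invr_ge0; lra.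
  - have -> : c^-1 * z.1 + 0 * z.2 + e / c + (0 * z.1 + c^-1 * z.2 + e / c) =
        (z.1 + z.2 + 2 * e) / c by field.
    by rewrite ler_pdivrMr// mul1r /c; lra.
pose Q (z : plane R) := 3 / 4 * (1 * xc z + 1 * yc z + - (2 / 3)) ^+ 2 +
  1 / 4 * (1 * xc z + (-1) * yc z + 0) ^+ 2.
have Q0 z : 0 <= Q z by rewrite addr_ge0// mulr_ge0 ?sqr_ge0//; lra.
have tl (K1 : set (plane R)) (tx1 : tame K1 xc) (ty1 : tame K1 yc) (a b d : R) :
    tame K1 (fun z => a * xc z + b * yc z + d).
  apply: tameD; last exact: tame_cst.
  by apply: tameD; apply: tameM => //; exact: tame_cst.
have tQ (K1 : set (plane R)) (tx1 : tame K1 xc) (ty1 : tame K1 yc) (a d : R) F :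
  tame K1 F -> tame K1 (fun z => a * F z ^+ 2).
  by move=> tF; apply: tameM; [exact: tame_cst|exact: tameX].
have tx0 := @tame_unit_triangle_xc R; have ty0 := @tame_unit_triangle_yc R.
have fT := @finite_area_unit_triangle R.
have QT : integ unit_triangle Q = 24^-1.
  rewrite (integD fT); [|exact: tQ 0 _ (tl _ _ _ _ _ _)..].
  rewrite !(integZ fT); [|exact: tameX (tl _ _ _ _ _ _)..].
  by rewrite !integ_unit_triangle_sqr; field.
have tQT : tame unit_triangle Q by apply: tameD; exact: tQ 0 _ (tl _ _ _ _ _ _).
have QG : Q \o G = fun z => c ^- 2 * Q z.
  apply/funext => z; rewrite /Q /G /aff /xc /yc /= /c; field.
  by rewrite -/c.
have tQG := tame_comp (let: And3 m _ _ := sG in m) tQT.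
have fG := scales_finite_area fT sG.
have tQG' : tame (G @^-1` unit_triangle) Q.
  have -> : Q = fun z => c ^+ 2 * (Q \o G) z.
    by apply/funext => z; rewrite QG; field.
  by apply: tameM => //; exact: tame_cst.
have intQ : integ (G @^-1` unit_triangle) Q = c ^+ 4 / 24.
  have := integ_scales fT sG tQT; rewrite QG (integZ fG)// QT => h.
  by rewrite -[LHS](mulKf (_ : c ^- 2 != 0)) ?h; [field|rewrite invr_eq0 expf_eq0].
have le1 : integ K Q <= c ^+ 4 / 24.
  rewrite -intQ; apply: le_integ_set => //; exact: measurable_body.
have V := normal_volume nK; set v := volume K in V hmu.
have h1 := covn_le_sqr (2 / 3) fK (tl K tx ty 1 1 0).
have h2 := covn_le_sqr 0 fK (tl K tx ty 1 (-1) 0).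
have QK : integ K Q = 3 / 4 * integ K (fun z => (1 * xc z + 1 * yc z + 0 - 2 / 3) ^+ 2) +
    1 / 4 * integ K (fun z => (1 * xc z + (-1) * yc z + 0 - 0) ^+ 2).
  rewrite (integD fK); [|exact: tQ 0 _ (tl _ _ _ _ _ _)..].
  rewrite !(integZ fK); [|exact: tameX (tl _ _ _ _ _ _)..].
  by congr (_ * integ _ _ + _ * integ _ _); apply/funext => z; rewrite ?addr0 ?subr0.
have tau : covn K xc xc + covn K xc yc + covn K yc yc <= v * (c ^+ 4 / 24).
  have : v * integ K Q <= v * (c ^+ 4 / 24) by rewrite ler_wpM2l//; lra.
  apply: le_trans; rewrite QK.
  move: h1 h2; rewrite -/v covn_lin//; try exact: tl.
  rewrite (covn_lin fK 1 (-1) 0)//; try exact: tl.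
  rewrite ![covn K _ (fun z => _ + _)]covnC !covn_lin// [covn K yc xc]covnC.
  by lra.
have cx0 := covn_ge0 fK tx (normal_volume_gt0 nK).
have cy0 := covn_ge0 fK ty (normal_volume_gt0 nK).
have g0 := normal_gram_gt0 nK.
move: hmu g0 tau; rewrite /gram.
move: (covn K xc xc) (covn K xc yc) (covn K yc yc) cx0 cy0 => x w y x0 y0 hmu g0 tau.
have tau0 : 0 <= x + w + y by nra.
have sq : (x + w + y) ^+ 2 <= (v * (c ^+ 4 / 24)) ^+ 2.
  by rewrite ler_pXn2r// nnegrE; lra.
(* the arithmetic-geometric inequality for the form x^2 + x y + y^2 *)
have d3 : 3 * (x * y - w ^+ 2) <= (x + w + y) ^+ 2.
  rewrite -subr_ge0 (_ : _ - _ = 3 / 4 * (x - y) ^+ 2 + ((x + y) / 2 + 2 * w) ^+ 2); last by field.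
  by have := sqr_ge0 (x - y); have := sqr_ge0 ((x + y) / 2 + 2 * w); lra.
have v2 : 0 < v ^+ 2 by rewrite exprn_gt0//; lra.
have m4 : mu * v ^+ 4 <= c ^+ 8 / 1728.
  rewrite -(ler_pM2r v2).
  have -> : mu * v ^+ 4 * v ^+ 2 = mu * v ^+ 6 by ring.
  have -> : c ^+ 8 / 1728 * v ^+ 2 = (v * (c ^+ 4 / 24)) ^+ 2 / 3 by field.
  lra.
have [mu0|mu0] := leP mu 0.
  have : 0 <= c ^+ 8 by rewrite exprn_ge0// ltW.
  lra.
(* this is where the lower bound 1/2 on the area enters: 1728 / 16 = 108 *)
have v4 : 16^-1 <= v ^+ 4.
  have -> : 16^-1 = (2^-1) ^+ 4 :> R by field.
  by rewrite ler_pXn2r// nnegrE; lra.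
have : mu * 16^-1 <= mu * v ^+ 4 by rewrite ler_pM2l.
lra.
Qed.

(** Apply [spread_squeezed] to bodies whose area approaches the infimum. *)
Lemma spread_le mu K : 0 < mu -> spread mu K -> 108 * mu <= 1.
Proof.
move=> mu0 sK.
have small (e : R) : 0 < e -> 108 * mu <= (1 + 3 * e) ^+ 8.
  move=> e0; pose W := [set v | exists2 K', spread mu K' & v = volume K'].
  have W2 v : W v -> 2^-1 <= v by move=> [K' [nK' _] ->]; exact: normal_volume.
  have hW : has_inf W by split; [exists (volume K), K|exists 2^-1].
  have i2 : 2^-1 <= inf W by apply: lb_le_inf => //; exists (volume K), K.
  have i0 : 0 < e * inf W by rewrite mulr_gt0//; lra.
  have [v [K' sK' ->]] := inf_adherent i0 hW => vi.
  apply: (spread_squeezed (ltW e0) sK').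
  apply: (spread_near_minimal sK') => K'' sK''.
  have : inf W <= volume K'' by apply: ge_inf; [case: hW|exists K''].
  move=> h; have : (1 + e) * inf W <= (1 + e) * volume K'' by rewrite ler_pM2l//; lra.
  lra.
rewrite leNgt; apply/negP => h.
have pow8 (x : R) : 0 <= x <= 1 -> (1 + x) ^+ 8 <= 1 + 255 * x.
  move=> /andP[x0 x1].
  have s2 : (1 + x) ^+ 2 <= 1 + 3 * x by nra.
  have s4 : (1 + x) ^+ 4 <= 1 + 15 * x.
    have -> : (1 + x) ^+ 4 = ((1 + x) ^+ 2) ^+ 2 by ring.
    have : ((1 + x) ^+ 2) ^+ 2 <= (1 + 3 * x) ^+ 2 by rewrite ler_pXn2r// ?nnegrE ?sqr_ge0//; lra.
    nra.
  have -> : (1 + x) ^+ 8 = ((1 + x) ^+ 4) ^+ 2 by ring.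
  have : ((1 + x) ^+ 4) ^+ 2 <= (1 + 15 * x) ^+ 2.
    by rewrite ler_pXn2r// ?nnegrE ?exprn_ge0//; lra.
  nra.
(* small enough for 255 x < 108 mu - 1, against (1 + x)^8 <= 1 + 255 x *)
pose x := Num.min 1 ((108 * mu - 1) / 256).
have x0 : 0 < x by rewrite lt_min ltr01 divr_gt0//; lra.
have x1 : x <= 1 by rewrite ge_min lexx.
have x2 : x <= (108 * mu - 1) / 256 by rewrite ge_min lexx orbT.
have e0 : 0 < x / 3 by rewrite divr_gt0.
have := small _ e0; rewrite (_ : 3 * (x / 3) = x); last by field.
have xx : 0 <= x <= 1 by rewrite x1 ltW.
have := pow8 _ xx; lra.
Qed.
End Extremal.

(** * The inequality for convex bodies *)

Section ConvexBodies.
Context {R : realType}.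
Implicit Types (K : set (R * R)).

Lemma calC_gram K : 0 < volume K -> calC K = volume K ^+ 6 / gram K xc yc.
Proof.
move=> V0; rewrite /calC; set v := volume K in V0 *.
have v0 : v != 0 by rewrite gt_eqF.
have -> : \det (Cov K) = gram K xc yc / v ^+ 4.
  rewrite (expand_det_row _ 0) !big_ord_recl big_ord0 /cofactor !det_mx11 /=.
  rewrite !mxE /=.
  have cE (i : 'I_2) : @Defs.coord R i = if (i : nat) == 0%N then xc else yc.
    by apply/funext => z; case: i => -[|[|n]].
  have mE F : mean K F = integ K F / v by [].
  rewrite !cE /= !mE /gram /covn -/v.
  have -> : integ K (fun z => yc z * xc z) = integ K (fun z => xc z * yc z).
    by congr integ; apply/funext => z; rewrite mulrC.
  rewrite /bump /= addn0 expr0 add0n expr1.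
  by field.
have [->|g0] := eqVneq (gram K xc yc) 0; first by rewrite mul0r invr0 !mulr0.
by field; rewrite g0.
Qed.

Lemma convex_body_body K : convex_body K -> body K.
Proof.
move=> [cK vK _]; split => // z w t Kz Kw /andP[t0 t1].
by have := vK z w (Itv01 t0 t1) (mem_set Kz) (mem_set Kw) => /set_mem.
Qed.

Lemma convex_body_corner K : convex_body K ->
  exists p q r, [/\ 0 < r, K (p, q), K (p + r, q) & K (p, q + r)].
Proof.
move=> [_ _ [[p q] /nbhs_ballP[e /= e0 eK]]].
have e2 : 0 < e / 2 by lra.
have eE : `|e / 2| = e / 2 by rewrite ger0_norm// ltW.
exists p, q, (e / 2); split => //; apply: eK; split => /=;
  rewrite -ball_normE /ball_ /= ?opprD ?addrA ?subrr ?sub0r ?normrN ?eE ?normr0; lra.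
Qed.

Lemma normalise K : convex_body K ->
  exists2 K', normal_body K' & calC K' = calC K.
Proof.
move=> cK; have bK := convex_body_body cK; have fK := finite_area_body bK.
have [p [q [r [r0 K1 K2 K3]]]] := convex_body_corner cK.
have rn : r != 0 by rewrite gt_eqF.
have DE : r * r - 0 * 0 = r ^+ 2 by ring.
have D0 : r * r - 0 * 0 != 0 by rewrite DE expf_neq0.
have nK' : normal_body (aff r 0 p 0 r q @^-1` K).
  split; first exact: body_aff.
  - by rewrite /preimage /= (_ : aff _ _ _ _ _ _ _ = (p, q))// /aff /=; congr pair; ring.
  - by rewrite /preimage /= (_ : aff _ _ _ _ _ _ _ = (p + r, q))// /aff /=; congr pair; ring.
  - by rewrite /preimage /= (_ : aff _ _ _ _ _ _ _ = (p, q + r))// /aff /=; congr pair; ring.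
exists (aff r 0 p 0 r q @^-1` K); first exact: nK'.
have V' := normal_volume_gt0 nK'.
have VE := volume_aff p q fK rn D0; rewrite DE (ger0_norm (sqr_ge0 r)) in VE.
have V : 0 < volume K.
  by move: V'; rewrite VE pmulr_lgt0// invr_gt0 exprn_gt0.
rewrite !calC_gram// VE (gram_aff _ _ fK (tame_xc bK) (tame_yc bK) rn D0) DE.
have [->|g0] := eqVneq (gram K xc yc) 0; first by rewrite mul0r invr0 !mulr0.
by field; rewrite g0.
Qed.

Lemma Delta20_pull :
  @Delta20 R = aff (2 / 3) (- (1 / 3)) (1 / 3) (- (1 / 3)) (2 / 3) (1 / 3) @^-1` unit_triangle.
Proof.
have sE (s t : R) : s *: (t : R^o) = s * t by [].
apply/seteqP; split => -[x y].
  move=> [a [b [c [a0 b0 c0 abc]]]] [-> ->].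
  by rewrite /aff; split => /=; rewrite /GRing.scale /=; lra.
move=> [/= h1 h2 h3]; rewrite /aff /= in h1 h2 h3.
exists ((1 + 2 * x - y) / 3), ((1 - x + 2 * y) / 3), ((1 - x - y) / 3).
split; [lra|lra|lra|lra|].
by congr pair; rewrite /= !sE; lra.
Qed.

Lemma calC_Delta20 : calC (@Delta20 R) = 108.
Proof.
have a0 : 2 / 3 != 0 :> R by rewrite mulf_neq0 ?invr_eq0 ?pnatr_eq0.
have DE : 2 / 3 * (2 / 3) - - (1 / 3) * - (1 / 3) = 3^-1 :> R by field.
have D0 : 2 / 3 * (2 / 3) - - (1 / 3) * - (1 / 3) != 0 :> R.
  by rewrite DE invr_eq0 pnatr_eq0.
have fT := @finite_area_unit_triangle R; have tx := @tame_unit_triangle_xc R; have ty := @tame_unit_triangle_yc R.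
have VE := volume_aff (1 / 3) (1 / 3) fT a0 D0.
have GE := gram_aff (1 / 3) (1 / 3) fT tx ty a0 D0.
rewrite -Delta20_pull DE ger0_norm ?invr_ge0// volume_unit_triangle in VE.
rewrite -Delta20_pull DE gram_unit_triangle in GE.
by rewrite calC_gram ?GE VE; [field|lra].
Qed.

(** [spread_le] for the largest admissible [mu], the ratio that [calC] inverts. *)
Lemma normal_calC_ge K : normal_body K -> 108 <= calC K.
Proof.
move=> nK; have V0 := normal_volume_gt0 nK; have g0 := normal_gram_gt0 nK.
rewrite calC_gram//; have V6 : 0 < volume K ^+ 6 by rewrite exprn_gt0.
have mu0 : 0 < gram K xc yc / volume K ^+ 6 by rewrite divr_gt0.
have sK : spread (gram K xc yc / volume K ^+ 6) K.
  by split => //; rewrite mulfVK// gt_eqF.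
have := spread_le mu0 sK.
by rewrite mulrA ler_pdivrMr// mul1r ler_pdivlMr.
Qed.
End ConvexBodies.

Theorem theorem1p15 (R : realType) :
  (forall K : set (R * R), convex_body K -> calC K >= calC (@Delta20 R)) /\
  calC (@Delta20 R) = 108.
Proof.
split; last exact: calC_Delta20.
move=> K /normalise[K' nK' <-]; rewrite calC_Delta20.
exact: normal_calC_ge.
Qed.
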